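(* Let $\phi^n\in H^1_{per}(\Omega)$, $\rho^n,U^n,V^n,W^n\in L^2_{per}(\Omega)$ be given, let $\delta t>0$, and consider the linear system for $(\phi^{n+1},\mu_\phi^{n+1},\rho^{n+1},\mu_\rho^{n+1})$ with periodic boundary conditions $$\frac{\phi^{n+1}-\phi^n}{\delta t}=M_1\Delta\mu_\phi^{n+1},\qquad \mu_\phi^{n+1}=-\epsilon\Delta\phi^{n+1}+P_1(\phi^{n+1},\rho^{n+1})+S_1^n,$$ $$\frac{\rho^{n+1}-\rho^n}{\delta t}=M_2\Delta\mu_\rho^{n+1},\qquad \mu_\rho^{n+1}=Q_1(\phi^{n+1},\rho^{n+1})+S_2^n,$$ where $$P_1(\phi,\rho)=\frac{2}{\epsilon}(\phi^n)^2\phi+\alpha\nabla\cdot(\rho\boldsymbol Z^n)-\alpha\nabla\cdot\big((\boldsymbol Z^n\cdot\nabla\phi)\boldsymbol Z^n\big),\qquad Q_1(\phi,\rho)=\alpha\rho-\alpha\boldsymbol Z^n\cdot\nabla\phi+\frac{\beta}{2}(H^n)^2\rho,$$ $$S_1^n=\frac1\epsilon\phi^nA_1+\alpha\nabla\cdot(B_1\boldsymbol Z^n),\qquad S_2^n=\alpha B_1+\beta H^nC_1,$$ $$A_1=U^n-2(\phi^n)^2,\quad B_1=V^n-\rho^n+\boldsymbol Z^n\cdot\nabla\phi^n,\quad C_1=W^n-\tfrac12H^n\rho^n,$$ with $\boldsymbol Z^n=\boldsymbol Z(\phi^n)$, $H^n=H(\rho^n)$. This linear system is symmetric (self-adjoint)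 and positive definite for the variables $(\phi^{n+1},\rho^{n+1})$, in the following sense. Let $\mathbb A$ be the linear operator of the reduced system (obtained by subtracting from $\phi^{n+1},\rho^{n+1}$ their known means and eliminating $\mu_\phi^{n+1},\mu_\rho^{n+1}$ by means of $\Delta^{-1}$), acting on pairs $\boldsymbol X=(X_1,X_2)$ of mean-zero periodic functions by $$\mathbb A\boldsymbol X=\Big(-\frac{1}{M_1\delta t}\Delta^{-1}X_1-\epsilon\Delta X_1+P_1(X_1,X_2),\ -\frac1{M_2\delta t}\Delta^{-1}X_2+Q_1(X_1,X_2)\Big)$$ (each component being taken modulo additive constants). Then for all pairs $\boldsymbol X=(X_1,X_2)$, $\boldsymbol Y=(Y_1,Y_2)$ of mean-zero functions with $X_1,Y_1\in H^1_{per}(\Omega)$, $X_2,Y_2\in L^2_{per}(\Omega)$, $$(\mathbb A\boldsymbol X,\boldsymbol Y)=(\mathbb A\boldsymbol Y,\boldsymbol X),\qquad (\mathbb A\boldsymbol X,\boldsymbol X)\ge 0,$$ and $(\mathbb A\boldsymbol X,\boldsymbol X)=0$ if and only if $\boldsymbol X=0$.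
   Context: $\Omega$ is a rectangular periodic box in $\mathbb R^d$, $d=2,3$ (e.g. $[0,2\pi]^d$); $L^2_{per}(\Omega)$, $H^1_{per}(\Omega)$ are the periodic $L^2$ and $H^1$ functions. $(f,g)=\int_\Omega fg\,d\boldsymbol x$ and $\|f\|=\sqrt{(f,f)}$; for pairs, $(\boldsymbol F,\boldsymbol Y)=(F_1,Y_1)+(F_2,Y_2)$. The differential terms are understood weakly: for $Y_1\in H^1_{per}(\Omega)$, $(-\Delta X_1,Y_1)$ means $(\nabla X_1,\nabla Y_1)$ and $(\nabla\cdot\boldsymbol F,Y_1)$ means $-(\boldsymbol F,\nabla Y_1)$. For a mean-zero periodic $u$, $v=\Delta^{-1}u$ is the mean-zero periodic solution of $\Delta v=u$. The parameters $\epsilon,\alpha,\beta,M_1,M_2$ are positive constants. $\boldsymbol Z(\phi)=\nabla\phi/|\nabla\phi|$, with the convention $\boldsymbol Z(\phi)=0$ where $\nabla\phi=0$. $H(\rho)=\dfrac{g(\rho)}{\sqrt{G(\rho)+B}}$ with $g=G'$, where $G:\mathbb R\to\mathbb R$ is the regularized Flory–Huggins potential: for a fixed small $\widehat\epsilon\in(0,1/2)$, $$G(\rho)=\begin{cases}\rho\ln\rho+\frac{(1-\rho)^2}{2\widehat\epsilon}+(1-\rho)\ln\widehat\epsilon-\frac{\widehat\epsilon}{2},&\rho\ge1-\widehat\epsilon,\\ \rho\ln\rho+(1-\rho)\ln(1-\rho),&\widehat\epsilon\le\rho\le1-\widehat\epsilon,\\ (1-\rho)\ln(1-\rho)+\frac{\rho^2}{2\widehat\epsilon}+\rho\ln\widehat\epsilon-\frac{\widehat\epsilon}{2},&\rho\le\widehat\epsilon,\end{cases}$$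 and $B>0$ is a constant such that $G(\rho)+B>0$ for all $\rho$ (e.g. $B=1$). Reduction: integrating the first and third equations shows $\int_\Omega\phi^{n+1}=\int_\Omega\phi^n$ and $\int_\Omega\rho^{n+1}=\int_\Omega\rho^n$, so the means are known; the mean-zero parts $(\phi,\rho)$ of $(\phi^{n+1},\rho^{n+1})$ then satisfy $\mathbb A(\phi,\rho)=\boldsymbol b$ modulo additive constants, with $\boldsymbol b$ depending only on known data. *)

(* Defs.v *)
From HB Require Import structures.
From mathcomp Require Import all_boot all_order all_algebra.
From mathcomp Require Import all_classical all_reals all_analysis.
Import Order.TTheory GRing.Theory Num.Theory.
Import numFieldNormedType.Exports.

Set Implicit Arguments.
Unset Strict Implicit.
Unset Printing Implicit Defensive.

Local Open Scope classical_set_scope.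
Local Open Scope ring_scope.

(* Points of R^d are d-tuples, which carry the product sigma-algebra.
   Row vectors are used only where the normed structure is needed, namely to
   differentiate test functions; to_row is the passage from one to the other. *)
Notation Rpoint R d := (d.-tuple (measurableTypeR R)).

Definition to_row (R : realType) (d : nat) (x : Rpoint R d) : 'rV[R]_d :=
  \row_i tnth x i.

Section LebesgueTuple.
Variable R : realType.

Definition tuple_cons (n : nat) (p : measurableTypeR R * Rpoint R n) :
  Rpoint R n.+1 := [tuple of p.1 :: p.2].

Lemma measurable_tuple_cons n : measurable_fun setT (@tuple_cons n).
Proof. exact: (measurable_cons measurable_fst measurable_snd). Qed.

Section Cons.
Variable n : nat.
Variable mu : {sigma_finite_measure set (Rpoint R n) -> \bar R}.

Definition lebesgue_cons : set (Rpoint R n.+1) -> \bar R :=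
  pushforward (lebesgue_measure \x mu)%E (@tuple_cons n).

Let lebesgue_cons0 : lebesgue_cons set0 = 0%E.
Proof. by rewrite /lebesgue_cons /pushforward preimage_set0 measure0. Qed.

Let lebesgue_cons_ge0 A : (0 <= lebesgue_cons A)%E.
Proof. by rewrite /lebesgue_cons /pushforward; exact: measure_ge0. Qed.

Let lebesgue_cons_sigma_additive : semi_sigma_additive lebesgue_cons.
Proof.
move=> F mF tF mUF; rewrite /lebesgue_cons /pushforward preimage_bigcup.
apply: measure_semi_sigma_additive.
- by move=> k; rewrite -[X in measurable X]setTI; exact: measurable_tuple_cons.
- apply/trivIsetP => /= i j _ _ ij; rewrite -preimage_setI.
  by move/trivIsetP : tF => /(_ _ _ _ _ ij) ->//; rewrite preimage_set0.
- rewrite -preimage_bigcup -[X in measurable X]setTI.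
  exact: measurable_tuple_cons.
Qed.

HB.instance Definition _ := isMeasure.Build _ _ _ lebesgue_cons
  lebesgue_cons0 lebesgue_cons_ge0 lebesgue_cons_sigma_additive.

Let lebesgue_cons_sigma_finite : sigma_finite setT lebesgue_cons.
Proof.
have /sigma_finiteP[F [TF ndF Foo]] := sigma_finiteT (@lebesgue_measure R).
have /sigma_finiteP[G [TG ndG Goo]] := sigma_finiteT mu.
pose h (x : Rpoint R n.+1) : measurableTypeR R * Rpoint R n :=
  (thead x, [tuple of behead x]).
have mh : measurable_fun setT h.
  by apply: measurable_fun_pair; [exact: measurable_tnth|
                                  exact: measurable_behead].
have hK : cancel (@tuple_cons n) h.
  by case=> t s; congr pair; apply/val_inj.
exists (fun k => h @^-1` (F k `*` G k)).
  apply/esym; rewrite -subTset => x _.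
  have : setT (thead x) by []. rewrite TF => -[i _ Fi].
  have : setT [tuple of behead x] by []. rewrite TG => -[j _ Gj].
  exists (maxn i j) => //; split => /=.
    by move: Fi; exact/subsetPset/ndF/leq_maxl.
  by move: Gj; exact/subsetPset/ndG/leq_maxr.
move=> k; have [mFk Fk] := Foo k; have [mGk Gk] := Goo k.
have mFG : measurable (F k `*` G k) by exact: measurableX.
split; first by rewrite -[X in measurable X]setTI; exact: mh.
rewrite /lebesgue_cons /pushforward -comp_preimage.
rewrite (_ : h \o _ = id) ?preimage_id; last by apply/funext => p; exact: hK.
by rewrite product_measure1E// lte_mul_pinfty// ge0_fin_numE.
Qed.

HB.instance Definition _ := Measure_isSigmaFinite.Build _ _ _ lebesgue_cons
  lebesgue_cons_sigma_finite.

End Cons.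

Fixpoint lebesgue_tuple (n : nat) :
    {sigma_finite_measure set (Rpoint R n) -> \bar R} :=
  if n is n'.+1 then lebesgue_cons (lebesgue_tuple n')
  else \d_([tuple] : Rpoint R 0).

End LebesgueTuple.

Section PeriodicBox.
Variables (R : realType) (d : nat).
Variables a L : 'I_d -> R.

(* The box is the product of the intervals [a i, a i + L i], and L i is the
   period in the i-th direction. *)

Notation pt := (Rpoint R d).

Definition box : set pt :=
  [set x | forall i, tnth x i \in `[a i, a i + L i]].

Lemma measurable_box : measurable box.
Proof.
rewrite (_ : box = \bigcap_(i in [set: 'I_d])
    ((fun x : pt => tnth x i) @^-1` `[a i, a i + L i])).
  apply: fin_bigcap_measurable => // i _.
  by rewrite -[X in measurable X]setTI; exact: measurable_tnth.
by apply/seteqP; split=> x /= bx i; [move=> _|]; exact: bx.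
Qed.

(* Lebesgue measure restricted to the box: it governs every integral, every
   Lebesgue space and every "almost everywhere" below. *)
Definition mu_box : {measure set pt -> \bar R} :=
  mrestr (lebesgue_tuple R d) measurable_box.

Definition translate (i : 'I_d) (x : pt) : pt :=
  [tuple tnth x j + (if j == i then L i else 0) | j < d].

Definition box_periodic (u : pt -> R) := forall i x, u (translate i x) = u x.

Definition L2per (u : pt -> R) := box_periodic u /\ u \in Lfun mu_box 2%:E.

Definition unit_vec (i : 'I_d) : 'rV[R]_d := delta_mx 0 i.

Definition partials (s : seq 'I_d) (psi : 'rV[R]_d -> R) : 'rV[R]_d -> R :=
  foldr (fun i f => 'D_(unit_vec i) f) psi s.

(* Smooth periodic functions: all iterated partial derivatives exist and are
   continuous. *)
Definition test_fun (psi : 'rV[R]_d -> R) :=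
  [/\ forall i y, psi (y + L i *: unit_vec i) = psi y,
      forall s, continuous (partials s psi) &
      forall s i y, derivable (partials s psi) y (unit_vec i)].

Definition is_weak_partial (i : 'I_d) (u g : pt -> R) :=
  L2per g /\
  forall psi, test_fun psi ->
    \int[mu_box]_x (u x * 'D_(unit_vec i) psi (to_row x)) =
    - (\int[mu_box]_x (g x * psi (to_row x))).

Definition H1per (u : pt -> R) :=
  L2per u /\ forall i, exists g, is_weak_partial i u g.

(* A representative of the weak gradient (determined almost everywhere). *)
Definition weak_grad (u : pt -> R) (i : 'I_d) : pt -> R :=
  xget (cst 0) [set g | is_weak_partial i u g].

Definition dot (F G : 'I_d -> pt -> R) (x : pt) : R := \sum_i F i x * G i x.

Definition mean_zero (u : pt -> R) := \int[mu_box]_x u x = 0.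

(* Weak expressions are represented by what they do when paired with a
   function Y. *)
Definition weak := (pt -> R) -> R^o.

Definition weak_fun (f : pt -> R) : weak :=
  fun Y => \int[mu_box]_x (f x * Y x).

Definition weak_laplacian (u : pt -> R) : weak :=
  fun Y => - (\int[mu_box]_x dot (weak_grad u) (weak_grad Y) x).

Definition weak_div (F : 'I_d -> pt -> R) : weak :=
  fun Y => - (\int[mu_box]_x dot F (weak_grad Y) x).

Definition is_inv_laplacian (u v : pt -> R) :=
  [/\ H1per v, mean_zero v &
      forall Y, H1per Y -> weak_laplacian v Y = weak_fun u Y].

Definition inv_laplacian (u : pt -> R) : pt -> R :=
  xget (cst 0) [set v | is_inv_laplacian u v].

(* Where the gradient of phi vanishes this is 0, since 0 / 0 = 0. *)
Definition Zfield (phi : pt -> R) (i : 'I_d) (x : pt) : R :=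
  weak_grad phi i x / Num.sqrt (dot (weak_grad phi) (weak_grad phi) x).

Definition Gpot (eh r : R) : R :=
  if 1 - eh <= r then
    r * ln r + (1 - r) ^+ 2 / (2 * eh) + (1 - r) * ln eh - eh / 2
  else if eh <= r then r * ln r + (1 - r) * ln (1 - r)
  else (1 - r) * ln (1 - r) + r ^+ 2 / (2 * eh) + r * ln eh - eh / 2.

Definition Hfun (eh B r : R) : R :=
  derive1 (Gpot eh) r / Num.sqrt (Gpot eh r + B).

Section Operator.
Variables (eps alpha beta M1 M2 eh B dt : R) (phin rhon : pt -> R).

Let Z := Zfield phin.
Let Hn (x : pt) := Hfun eh B (rhon x).

Definition P1 (phi rho : pt -> R) : weak :=
  (2 / eps) *: weak_fun (fun x => phin x ^+ 2 * phi x)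
  + alpha *: weak_div (fun i x => rho x * Z i x)
  - alpha *: weak_div (fun i x => dot Z (weak_grad phi) x * Z i x).

Definition Q1 (phi rho : pt -> R) : weak :=
  alpha *: weak_fun rho
  - alpha *: weak_fun (dot Z (weak_grad phi))
  + (beta / 2) *: weak_fun (fun x => Hn x ^+ 2 * rho x).

Definition opA (X : (pt -> R) * (pt -> R)) : weak * weak :=
  (- ((M1 * dt)^-1 *: weak_fun (inv_laplacian X.1))
     - eps *: weak_laplacian X.1 + P1 X.1 X.2,
   - ((M2 * dt)^-1 *: weak_fun (inv_laplacian X.2)) + Q1 X.1 X.2).

End Operator.

(* Only mean-zero Y are ever used, so that adding constants to the components
   of F would make no difference. *)
Definition pairing (F : weak * weak) (Y : (pt -> R) * (pt -> R)) : R :=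
  F.1 Y.1 + F.2 Y.2.

Definition admissible (X : (pt -> R) * (pt -> R)) :=
  [/\ H1per X.1, L2per X.2, mean_zero X.1 & mean_zero X.2].

End PeriodicBox.

(* Main.v *)
Require Import Defs.
From mathcomp Require Import all_boot all_order all_algebra.
From mathcomp Require Import all_classical all_reals all_analysis.
From mathcomp Require Import measurable_realfun.
From mathcomp Require Import ring lra.
Import Order.TTheory GRing.Theory Num.Theory.
Import numFieldNormedType.Exports.

(** Writing [G u] for [Z . grad u], the form of the theorem is, by [pairing_opA],
<<
  (A X, Y) =   1/(M1 dt) (grad v1(X), grad v1(Y)) + 1/(M2 dt) (grad v2(X), grad v2(Y))
             + eps (grad X1, grad Y1) + 2/eps (phin^2 X1, Y1) + beta/2 (H^2 X2, Y2)
             + alpha (X2 - G X1, Y2 - G Y1)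
>>
where [vi(X)] is the inverse Laplacian of [Xi].  The first two terms are
[(- v, Y) = (grad v, grad w)] for [w] the inverse Laplacian of [Y], and the
alpha-terms of [P1] and [Q1] combine to the last product because the weak
divergence of [r Z], paired with [Y], is [- (r, Z . grad Y)].  Each summand is
symmetric, and is nonnegative for [Y = X] ([pairing_opA_sym],
[pairing_opA_ge]).  If the form vanishes at [X] then [grad X1 = 0], so [X1 = 0]
because [X1] has mean zero; then [G X1 = 0], and the alpha-square leaves
[X2 = 0] ([pairing_opA_eq0]).

All of this supposes that the inverse Laplacian, which is defined by choice,
really is a solution, and that weak gradients are determined almost
everywhere.  Both are obtained from Fourier series.  The real trigonometric
monomials [e_m] of the box are orthogonal, are eigenfunctions of the Laplacian
for eigenvalues [- lambda_m], and are test functions.  For [u] of mean zero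
with coefficients [c_m] the series [v = - sum (c_m / lambda_m) e_m] and its
termwise derivatives converge in L2, the nonzero eigenvalues being bounded away
from 0 ([lambda_gap]); Parseval's formula for [u] then shows that [v] solves
[Delta v = u] ([inv_laplacian_exists]).

The convergence rests on the completeness of L2 ([L2_complete]) and Parseval's
formula on the totality of the trigonometric system ([total_modes]), from which
the uniqueness of weak derivatives follows too ([weak_partial_unique]).  Totality
is proved by induction on the dimension, slicing the box with Fubini's theorem.
In one dimension ([total_mode1]) an arc of the circle is a superlevel set of a
shifted cosine, so its indicator is a bounded pointwise limit of polynomials
in that cosine ([step_poly_cvg]); a function orthogonal to the trigonometric
system therefore has integral zero over every interval, and vanishes almost
everywhere by Lebesgue's differentiation theorem. *)

Local Open Scope classical_set_scope.
Local Open Scope ring_scope.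
Set Implicit Arguments.
Unset Strict Implicit.
Unset Printing Implicit Defensive.

(** * Inner product of square-integrable functions *)

Lemma Rintegral_sum d (T : measurableType d) (R : realType)
    (mu : {measure set T -> \bar R}) (I : Type) (r : seq I) (F : I -> T -> R) :
  (forall i, mu.-integrable setT (EFin \o F i)) ->
  mu.-integrable setT (EFin \o (fun x => \sum_(i <- r) F i x)) /\
  \int[mu]_x (\sum_(i <- r) F i x) = \sum_(i <- r) \int[mu]_x F i x.
Proof.
move=> Fi; elim: r => [|i r [IH1 IH2]].
  split; last by rewrite big_nil; under eq_Rintegral do rewrite big_nil;
    rewrite Rintegral_cst// mul0r.
  by under [X in _.-integrable _ X]eq_fun do rewrite /= big_nil; exact: integrable0.
split.
  under [X in _.-integrable _ X]eq_fun do rewrite /= big_cons EFinD.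
  exact: (integrableD measurableT (Fi i) IH1).
by rewrite big_cons; under eq_Rintegral do rewrite big_cons; rewrite RintegralD// IH2.
Qed.

Section L2.
Context d (T : measurableType d) (R : realType).
Variable mu : {measure set T -> \bar R}.
Implicit Types f g h : T -> R.

Definition L2 : set (T -> R) := [set f | f \in Lfun mu 2%:E].

Definition ip f g := \int[mu]_x (f x * g x).

Lemma L2_measurable f : L2 f -> measurable_fun setT f.
Proof. by rewrite /L2/= inE => /andP[] /[!inE]. Qed.

Lemma L2_integrable_mul f g : L2 f -> L2 g ->
  mu.-integrable setT (EFin \o (fun x => f x * g x)).
Proof. by move=> f2 g2; apply/Lfun1_integrable/Lfun2_mul_Lfun1. Qed.

Lemma L2P f : measurable_fun setT f ->
  mu.-integrable setT (EFin \o (fun x => f x * f x)) -> L2 f.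
Proof.
move=> mf /integrableP[_ fi]; rewrite /L2/= inE; apply/andP; split; rewrite inE//=.
rewrite /finite_norm unlock; apply: poweR_lty.
apply: le_lt_trans fi; rewrite le_eqVlt; apply/orP; left; apply/eqP.
apply: eq_integral => x _ /=; congr EFin.
by rewrite powR_mulrn// expr2 normrM.
Qed.

Lemma L2_dominated f g : measurable_fun setT f -> L2 g ->
  (forall x, `|f x| <= `|g x|) -> L2 f.
Proof.
move=> mf g2 fg; apply: L2P => //.
apply: le_integrable (L2_integrable_mul g2 g2) => //.
  by apply/measurable_EFinP; exact: measurable_funM.
by move=> x _; rewrite /= lee_fin !normrM ler_pM.
Qed.

Lemma L2D f g : L2 f -> L2 g -> L2 (fun x => f x + g x).
Proof.
move=> f2 g2; have mf := L2_measurable f2; have mg := L2_measurable g2.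
apply: L2P; first exact: measurable_funD.
rewrite (_ : _ \o _ = (fun x => (f x * f x)%:E + ((f x * g x)%:E + (f x * g x)%:E)
  + (g x * g x)%:E)%E); last first.
  by apply/funext => x /=; rewrite -!EFinD; congr EFin; ring.
by apply: integrableD => //; [apply: integrableD => //; [|apply: integrableD => //]|];
  exact: L2_integrable_mul.
Qed.

Lemma L2Z a f : L2 f -> L2 (fun x => a * f x).
Proof.
move=> f2; have mf := L2_measurable f2.
apply: L2P; first exact: measurable_funM.
rewrite (_ : _ \o _ = (fun x => (a * a)%:E * (f x * f x)%:E)%E); last first.
  by apply/funext => x /=; rewrite -EFinM; congr EFin; ring.
by apply: integrableZl => //; exact: L2_integrable_mul.
Qed.

Lemma L2_0 : L2 (fun=> 0).
Proof.
apply: L2P => //.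
by rewrite (_ : _ \o _ = cst 0%E); [exact: integrable0|
  apply/funext => x /=; rewrite mul0r].
Qed.

Lemma L2B f g : L2 f -> L2 g -> L2 (fun x => f x - g x).
Proof.
move=> f2 g2; rewrite (_ : (fun x => _) = (fun x => f x + (-1) * g x)).
  by apply: L2D => //; exact: L2Z.
by apply/funext => x; rewrite mulN1r.
Qed.

Lemma L2_sum (I : Type) (r : seq I) (F : I -> T -> R) :
  (forall i, L2 (F i)) -> L2 (fun x => \sum_(i <- r) F i x).
Proof.
move=> F2; elim: r => [|i r IH].
  by under eq_fun do rewrite big_nil; exact: L2_0.
by under eq_fun do rewrite big_cons; exact: L2D.
Qed.

Lemma integrable_cstr (r : R) : (mu setT < +oo)%E ->
  mu.-integrable setT (fun=> r%:E).
Proof.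
move=> muT; apply/integrableP; split=> //=.
by rewrite integral_cst// lte_mul_pinfty.
Qed.

Lemma L2_bounded f (M : R) : (mu setT < +oo)%E -> measurable_fun setT f ->
  (forall x, `|f x| <= M) -> L2 f.
Proof.
move=> muT mf fM; apply: L2P => //.
apply: (le_integrable measurableT (g := cst (M * M)%:E)) => //.
- by apply/measurable_EFinP; exact: measurable_funM.
- move=> x _; rewrite /= lee_fin normrM (le_trans _ (ler_norm _))//.
  by rewrite ler_pM.
- exact: integrable_cstr.
Qed.

Lemma ipC f g : ip f g = ip g f.
Proof. by apply: eq_Rintegral => x _; rewrite mulrC. Qed.

Lemma ipDl f g h : L2 f -> L2 g -> L2 h ->
  ip (fun x => f x + g x) h = ip f h + ip g h.
Proof.
move=> f2 g2 h2; rewrite -RintegralD//; do ?exact: L2_integrable_mul.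
by apply: eq_Rintegral => x _; rewrite mulrDl.
Qed.

Lemma ipZl a f h : L2 f -> L2 h -> ip (fun x => a * f x) h = a * ip f h.
Proof.
move=> f2 h2; rewrite -RintegralZl//; do ?exact: L2_integrable_mul.
by apply: eq_Rintegral => x _; rewrite mulrA.
Qed.

Lemma ipBl f g h : L2 f -> L2 g -> L2 h ->
  ip (fun x => f x - g x) h = ip f h - ip g h.
Proof.
move=> f2 g2 h2; rewrite -RintegralB//; do ?exact: L2_integrable_mul.
by apply: eq_Rintegral => x _; rewrite mulrBl.
Qed.

Lemma ip0l h : ip (fun=> 0) h = 0.
Proof.
rewrite /ip (_ : (fun x => _) = cst 0) ?Rintegral_cst ?mul0r//.
by apply/funext => x; rewrite mul0r.
Qed.

Lemma ip_suml (I : Type) (r : seq I) (F : I -> T -> R) h :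
  (forall i, L2 (F i)) -> L2 h ->
  ip (fun x => \sum_(i <- r) F i x) h = \sum_(i <- r) ip (F i) h.
Proof.
move=> F2 h2; elim: r => [|i r IH].
  by under eq_fun do rewrite big_nil; rewrite big_nil ip0l.
under eq_fun do rewrite big_cons.
by rewrite big_cons ipDl ?IH//; exact: L2_sum.
Qed.

Lemma ip_ge0 f : 0 <= ip f f.
Proof. by apply: Rintegral_ge0 => x _; rewrite -expr2 sqr_ge0. Qed.

Lemma ip_eq0 f : L2 f -> ip f f = 0 -> {ae mu, forall x, f x = 0}.
Proof.
move=> f2 /eqP; have fi := L2_integrable_mul f2 f2.
rewrite /ip /Rintegral -[X in X == _]/(fine _) => f0.
have : (\int[mu]_x `|(EFin \o (fun x => (f x * f x)%R)) x| = 0)%E.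
  rewrite (_ : (fun x => _) = (EFin \o (fun x => f x * f x))).
    by rewrite -(@fineK _ (\int[mu]_x _)%E) ?(eqP f0)//; exact: integrable_fin_num.
  by apply/funext => x /=; rewrite ger0_norm// -expr2 sqr_ge0.
move/(ae_eq_integral_abs mu measurableT (measurable_int _ fi)).
apply: filterS => x /(_ I)/= [] /eqP.
by rewrite mulf_eq0 orbb => /eqP.
Qed.

Lemma ae_eq_ip f g h : measurable_fun setT f -> measurable_fun setT g ->
  measurable_fun setT h ->
  {ae mu, forall x, f x = g x} -> ip f h = ip g h.
Proof.
move=> mf mg mh fg; rewrite /ip /Rintegral; congr fine.
apply: ae_eq_integral => //.
- by apply/measurable_EFinP; exact: measurable_funM.
- by apply/measurable_EFinP; exact: measurable_funM.
- by apply: filterS fg => x fgx _; rewrite fgx.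
Qed.

Lemma ip_sub f g : L2 f -> L2 g ->
  ip (fun x => f x - g x) (fun x => f x - g x) = ip f f - ip f g - ip g f + ip g g.
Proof.
move=> f2 g2; have fg2 := L2B f2 g2.
by rewrite ipBl// (ipC f) (ipC g) !ipBl//; ring.
Qed.

Lemma ip_lincomb f g a b : L2 f -> L2 g ->
  ip (fun x => a * f x - b * g x) (fun x => a * f x - b * g x) =
  a ^+ 2 * ip f f - 2 * (a * b) * ip f g + b ^+ 2 * ip g g.
Proof.
move=> f2 g2; have af := L2Z a f2; have bg := L2Z b g2.
by rewrite ip_sub// !ipZl// ![ip _ (fun x => _ * _)]ipC !ipZl// (ipC g f); ring.
Qed.

(** Nonnegativity of the quadratic form [a^2 (f,f) - 2ab (f,g) + b^2 (g,g)] at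
    [a = (g,g), b = (f,g)] settles the case [(g,g) > 0]; when [(g,g) = 0], the
    values [a = (f,g), b = ((f,f) + 1) / 2] force [(f,g) = 0]. *)
Lemma cauchy_schwarz f g : L2 f -> L2 g -> ip f g ^+ 2 <= ip f f * ip g g.
Proof.
move=> f2 g2.
have H a b : 0 <= a ^+ 2 * ip f f - 2 * (a * b) * ip f g + b ^+ 2 * ip g g.
  by rewrite -ip_lincomb// ip_ge0.
have H1 := H (ip g g) (ip f g); have H2 := H (ip f g) ((ip f f + 1) / 2).
have := ip_ge0 g; move: H1 H2.
move: (ip f f) (ip f g) (ip g g) => x y z H1 H2.
rewrite le_eqVlt => /orP[/eqP z0|z0]; first by subst z; lra.
by rewrite -subr_ge0 -(pmulr_rge0 _ z0); lra.
Qed.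
End L2.

(** * Completeness of L2 *)

Section L2_complete.
Context d (T : measurableType d) (R : realType).
Variable mu : {measure set T -> \bar R}.

(** The increments have a finite sum in L1, so by monotone convergence their
    sum is finite almost everywhere and the telescoping series converges. *)
Lemma summable_ae_cvg (w : nat -> T -> R) (C : R) :
  (forall k, measurable_fun setT (w k)) ->
  (forall k, (\int[mu]_x `|w k.+1 x - w k x|%:E <= (C / 2 ^+ k.+1)%:E)%E) ->
  {ae mu, forall x, cvgn (fun k => w k x)}.
Proof.
move=> mw hw.
have C0 : 0 <= C.
  have := hw 0; apply: contraTT; rewrite -!ltNge => C0.
  by rewrite (lt_le_trans _ (integral_ge0 _ _))// lte_fin expr1 nmulr_rlt0 ?invr_gt0.
pose D k x : \bar R := `|w k.+1 x - w k x|%:E.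
have mD k : measurable_fun setT (D k).
  by apply/measurable_EFinP; apply: measurableT_comp => //; exact: measurable_funB.
have D0 k x : setT x -> (0 <= D k x)%E by rewrite lee_fin.
have mS : measurable_fun setT (fun x => \sum_(k <oo) D k x)%E.
  by apply: (@ge0_emeasurable_sum _ _ _ setT D xpredT) => // k x _ _; exact: D0.
have iS : mu.-integrable setT (fun x => \sum_(k <oo) D k x)%E.
  apply/integrableP; split=> //.
  apply: (@le_lt_trans _ _ C%:E); last by rewrite ltry.
  have S0 x : (0 <= \sum_(k <oo) D k x)%E by apply: nneseries_ge0 => k _ _; exact: D0.
  under eq_integral => x _ do rewrite (gee0_abs (S0 x)).
  rewrite integral_nneseries//; apply: lime_le.
    by apply: is_cvg_nneseries => n _ _; apply: integral_ge0 => x; exact: D0.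
  apply: nearW => n; apply: (@le_trans _ _ (C * (1 - (2 ^+ n)^-1))%:E); last first.
    by rewrite lee_fin ler_piMr// gerBl invr_ge0 exprn_ge0.
  elim: n => [|n IH]; first by rewrite big_geq// expr0 invr1 subrr mulr0.
  rewrite big_nat_recr//= (le_trans (leeD IH (hw n)))//.
  rewrite -EFinD lee_fin exprS invfM.
  by rewrite le_eqVlt; apply/orP; left; apply/eqP; field; rewrite expf_neq0.
have := integrable_ae measurableT iS; apply: filterS => x /(_ I) Sfin.
suff : cvgn (series (telescope (fun k => w k x))).
  move=> /(cvgD (cvg_cst (w 0 x))) /cvgP.
  by under [X in cvgn X -> _]eq_fun do rewrite -eq_sum_telescope.
apply: normed_cvg; apply: nondecreasing_is_cvgn.
  apply/nondecreasing_seqP => n; rewrite -subr_ge0.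
  rewrite /normed_series_of.
  by rewrite seriesSB; exact: normr_ge0.
exists (fine (\sum_(k <oo) D k x)%E) => _ [n _ <-] /=.
rewrite -lee_fin fineK// /series/= -sumEFin; apply: (nneseries_lim_ge (P := xpredT)).
by move=> k _ _; exact: D0.
Qed.

Lemma limn_einf_le_near (a : nat -> \bar R) (e : \bar R) N :
  (forall n, (N <= n)%N -> (a n <= e)%E) -> (limn_einf a <= e)%E.
Proof.
move=> ae; rewrite limn_einf_lim; apply: lime_le; first exact: is_cvg_einfs.
apply: nearW => n; apply: le_trans (ae (maxn n N) _); last exact: leq_maxr.
by apply: ereal_inf_lbound; exists (maxn n N) => //=; exact: leq_maxl.
Qed.

(** Riesz-Fischer: a rapidly Cauchy subsequence converges almost everywhere, and
    Fatou's lemma turns this into convergence in L2.  The limit is taken to be the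
    pointwise upper limit of the subsequence, so that [v x] depends only on the
    values [u n x]; this is how periodicity is inherited by [v]. *)
Lemma L2_complete (u : nat -> T -> R) : (mu setT < +oo)%E ->
  (forall n, L2 mu (u n)) ->
  (forall e : R, 0 < e -> exists N, forall m n, (N <= m)%N -> (N <= n)%N ->
    ip mu (fun x => u m x - u n x) (fun x => u m x - u n x) <= e) ->
  exists v, [/\ L2 mu v, forall x y, (forall n, u n x = u n y) -> v x = v y &
    (fun n => ip mu (fun x => u n x - v x) (fun x => u n x - v x)) @ \oo --> 0].
Proof.
move=> muT u2 uC.
have mu_ n : measurable_fun setT (u n) by exact: L2_measurable.
have [N HN] : {N : nat -> nat & forall k m n, (N k <= m)%N -> (N k <= n)%N ->
    ip mu (fun x => u m x - u n x) (fun x => u m x - u n x) <= (4 ^+ k.+1)^-1}.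
  apply: (@choice _ _ (fun k N => forall m n, (N <= m)%N -> (N <= n)%N ->
    ip mu (fun x => u m x - u n x) (fun x => u m x - u n x) <= (4 ^+ k.+1)^-1)).
  by move=> k; apply: uC; rewrite invr_gt0 exprn_gt0.
(* partial sums make the subsequence of indices increasing *)
pose M k := (\sum_(i < k.+1) N i)%N.
have NM k : (N k <= M k)%N by rewrite /M big_ord_recr /= leq_addl.
have MM k : (M k <= M k.+1)%N by rewrite /M [leqRHS]big_ord_recr /= leq_addr.
have Nmono k j : (k <= j)%N -> (N k <= M j)%N.
  move=> kj; apply: (leq_trans (NM k)); elim: j kj => [|j IH].
    by rewrite leqn0 => /eqP ->.
  by rewrite leq_eqVlt ltnS => /predU1P[->//|/IH h]; exact: leq_trans (MM _).
pose w k := u (M k).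
pose v x := fine (limn_esup (fun k => (w k x)%:E)).
have mv : measurable_fun setT v.
  apply: measurableT_comp; first exact: fine_measurable.
  by apply: measurable_fun_limn_esup => k; apply/measurable_EFinP; exact: mu_.
pose c := fine (mu setT).
have cE : mu setT = c%:E by rewrite fineK// ge0_fin_numE.
have c0 : 0 <= c by rewrite fine_ge0.
have wcvg : {ae mu, forall x, cvgn (fun k => w k x)}.
  apply: (summable_ae_cvg (C := 1 + c)) => [k|k]; first exact: mu_.
  set z := fun x => w k.+1 x - w k x.
  have z2 : L2 mu z by apply: L2B; exact: u2.
  have ipz : ip mu z z <= (4 ^+ k.+1)^-1.
    by apply: HN => //; exact: leq_trans (MM _).
  (* L2 smallness gives L1 smallness on a finite measure space through
     [`|z| <= q z^2 + 1/q], with [q = 2 ^ k.+1] matching the bound on [z] *)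
  pose q : R := 2 ^+ k.+1.
  have q0 : 0 < q by rewrite exprn_gt0.
  apply: (@le_trans _ _ (\int[mu]_x ((q * (z x * z x))%R%:E + (q^-1)%R%:E))%E).
    apply: ge0_le_integral => //.
    - by apply/measurable_EFinP/measurableT_comp => //; exact: L2_measurable z2.
    - apply: emeasurable_funD => //; apply/measurable_EFinP.
      apply: measurable_funM => //; apply: measurable_funM; exact: L2_measurable z2.
    - move=> x _; rewrite -EFinD lee_fin -/(z x) -[z x * z x]expr2 -real_normK ?num_real//.
      set y : R := `|z x|.
      have : 0 <= q^-1 * ((q * y - 1) ^+ 2 + q * y).
        apply: mulr_ge0; first by rewrite invr_ge0 ltW.
        apply: addr_ge0; first exact: sqr_ge0.
        by apply: mulr_ge0; [exact: ltW|exact: normr_ge0].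
      rewrite -subr_ge0; move/le_trans; apply; rewrite le_eqVlt; apply/orP; left; apply/eqP; field; exact: lt0r_neq0.
  have zi := L2_integrable_mul z2 z2.
  rewrite integralD//; last 2 first.
  - under eq_fun do rewrite EFinM; exact: integrableZl.
  - exact: integrable_cstr.
  rewrite integral_cst//; under eq_integral do rewrite EFinM.
  rewrite integralZl// cE -EFinM.
  have -> : (\int[mu]_x (z x * z x)%:E)%E = (ip mu z z)%:E.
    by rewrite /ip /Rintegral fineK//; exact: integrable_fin_num.
  rewrite -EFinM -EFinD lee_fin mulrDl mul1r [q^-1 * c]mulrC lerD2r.
  by rewrite -ler_pdivlMl// -invfM -exprMn -natrM.
have vlim : {ae mu, forall x, w k x @[k --> \oo] --> v x}.
  apply: filterS wcvg => x /cvg_ex[l wl].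
  rewrite (_ : v x = l)//.
  have wl' : (w k x)%:E @[k --> \oo] --> l%:E by exact/cvg_EFin/wl/nearW.
  by rewrite /v (cvg_limn_einf_sup wl').
pose sq n x := (u n x - v x) * (u n x - v x).
have fatou_bound k n : (N k <= n)%N ->
    (\int[mu]_x (sq n x)%:E <= (4 ^+ k.+1)^-1%:E)%E.
  move=> kn.
  pose f j x := ((u n x - w j x) * (u n x - w j x))%:E.
  have -> : (\int[mu]_x (sq n x)%:E = \int[mu]_x limn_einf (f ^~ x))%E.
    apply: ae_eq_integral => //.
    - by apply/measurable_EFinP; apply: measurable_funM; exact: measurable_funB.
    - apply: (eq_measurable_fun (fun x => - limn_esup ((fun j x => - f j x) ^~ x))%E) => //.
      apply: measurableT_comp => //; apply: measurable_fun_limn_esup => j.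
      apply: measurableT_comp => //; apply/measurable_EFinP.
      by apply: measurable_funM; apply: measurable_funB => //; exact: mu_.
    - apply: filterS vlim => x wv _; apply/esym; apply: (cvg_limn_einf_sup _).1.
      apply: cvg_EFin; first exact: nearW.
      by apply: cvgM; apply: cvgB => //; exact: cvg_cst.
  apply: le_trans (fatou _ _ _ _) _ => //.
  - move=> j; apply/measurable_EFinP.
    by apply: measurable_funM; apply: measurable_funB => //; exact: mu_.
  - by move=> j x _; rewrite lee_fin -expr2 sqr_ge0.
  apply: (limn_einf_le_near (N := k)) => j kj.
  have z2 : L2 mu (fun x => u n x - w j x) by apply: L2B; exact: u2.
  have -> : (\int[mu]_x f j x)%E =
      (ip mu (fun x => u n x - w j x) (fun x => u n x - w j x))%:E.
    rewrite /ip /Rintegral fineK//; apply: integrable_fin_num => //.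
    exact: L2_integrable_mul.
  by rewrite lee_fin; apply: HN => //; exact: Nmono.
have d2 n k : (N k <= n)%N -> L2 mu (fun x => u n x - v x).
  move=> kn; apply: L2P; first exact: measurable_funB.
  apply/integrableP; split.
    by apply/measurable_EFinP; apply: measurable_funM; exact: measurable_funB.
  under eq_integral do rewrite /= ger0_norm -?expr2 ?sqr_ge0// expr2.
  by apply: le_lt_trans (fatou_bound _ _ kn) _; rewrite ltry.
exists v; split.
- rewrite (_ : v = fun x => u (N 0) x - (u (N 0) x - v x)).
    by apply: L2B => //; exact: d2.
  by apply/funext => x; rewrite subKr.
- by move=> x y xy; rewrite /v; do 2 f_equal; apply/funext => k; rewrite /w xy.
- apply/cvgrPdist_le => e e0.
  have : (fun k => (4^-1 : R) ^+ k) @ \oo --> (0 : R).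
    by apply: cvg_expr; rewrite ger0_norm// invf_lt1// ltr1n.
  move=> /cvgrPdist_le /(_ e e0)[k _ /(_ k.+1 (leqnSn _))]/=.
  rewrite exprVn => ke.
  exists (N k) => // n /= kn.
  rewrite sub0r normrN ger0_norm ?ip_ge0//.
  rewrite (le_trans _ ke)// sub0r normrN ger0_norm ?invr_ge0 ?exprn_ge0//.
  rewrite -lee_fin (le_trans _ (fatou_bound _ _ kn))// /ip /Rintegral fineK//.
  by apply: integrable_fin_num => //; apply: L2_integrable_mul; exact: d2 kn.
Qed.
End L2_complete.

(** * Orthogonal series *)

Section orthogonal_series.
Context d (T : measurableType d) (R : realType).
Variable mu : {measure set T -> \bar R}.

(** Convergence in L2 implies weak convergence, by the Cauchy-Schwarz inequality. *)
Lemma L2_cvg_ip (u : nat -> T -> R) v h : (forall n, L2 mu (u n)) -> L2 mu v ->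
  (fun n => ip mu (fun x => u n x - v x) (fun x => u n x - v x)) @ \oo --> 0 ->
  L2 mu h -> (fun n => ip mu (u n) h) @ \oo --> ip mu v h.
Proof.
move=> u2 v2 uv h2; apply/cvgrPdist_le => e e0.
have d2 n : L2 mu (fun x => u n x - v x) by exact: L2B.
have k0 : 0 < ip mu h h + 1 by rewrite ltr_wpDl// ip_ge0.
have e'0 : 0 < e ^+ 2 / (ip mu h h + 1) by rewrite divr_gt0 ?exprn_gt0.
move/cvgrPdist_le : uv => /(_ _ e'0); apply: filterS => n.
rewrite sub0r normrN ger0_norm ?ip_ge0// => un.
rewrite distrC -ipBl// -(@ler_pXn2r _ 2)// ?nnegrE//; last exact: ltW.
rewrite real_normK ?num_real//.
apply: (le_trans (cauchy_schwarz (d2 n) h2)).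
have := ip_ge0 mu h; move: un; rewrite ler_pdivlMr//.
have := ip_ge0 mu (fun x => u n x - v x).
by move: (ip _ _ _) (ip mu h h) => p q; nra.
Qed.

Variable E : nat -> T -> R.
Hypothesis E2 : forall n, L2 mu (E n).
Hypothesis Eorth : forall m n, m != n -> ip mu (E m) (E n) = 0.

Definition psum (b : nat -> R) n x := \sum_(0 <= k < n) b k * E k x.

Lemma psum_L2 b n : L2 mu (psum b n).
Proof. by apply: L2_sum => k; exact: L2Z. Qed.

Lemma ip_psuml b n h : L2 mu h ->
  ip mu (psum b n) h = \sum_(0 <= k < n) b k * ip mu (E k) h.
Proof.
move=> h2; rewrite ip_suml//; last by move=> k; exact: L2Z.
by apply: eq_bigr => k _; rewrite ipZl.
Qed.

Lemma ip_orthogonal_sum b (r : seq nat) : uniq r ->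
  ip mu (fun x => \sum_(k <- r) b k * E k x) (fun x => \sum_(k <- r) b k * E k x) =
  \sum_(k <- r) b k ^+ 2 * ip mu (E k) (E k).
Proof.
move=> ur; have bE2 k : L2 mu (fun x => b k * E k x) by exact: L2Z.
rewrite ip_suml//; last exact: L2_sum.
apply: eq_big_seq => k kr.
rewrite ipC ip_suml// (bigD1_seq k)//= big1 ?addr0.
  by rewrite ipZl// ipC ipZl// mulrA.
by move=> j jk; rewrite ipZl// ipC ipZl// Eorth 1?eq_sym// !mulr0.
Qed.

(** Partial sums are Cauchy because their squared distances are differences of
    the bounded increasing sequence of sums of [b k ^+ 2 * (E k, E k)].  Some [E k]
    may be zero: an enumeration of the trigonometric system produces such terms. *)
Lemma orthogonal_series_cvg b C : (mu setT < +oo)%E ->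
  (forall n, \sum_(0 <= k < n) b k ^+ 2 * ip mu (E k) (E k) <= C) ->
  exists v, [/\ L2 mu v, forall x y, (forall n, E n x = E n y) -> v x = v y &
    forall h, L2 mu h -> (fun n => ip mu (psum b n) h) @ \oo --> ip mu v h].
Proof.
move=> muT bC.
pose s n := \sum_(0 <= k < n) b k ^+ 2 * ip mu (E k) (E k).
have sS n : s n <= s n.+1.
  by rewrite /s big_nat_recr//= lerDl mulr_ge0 ?sqr_ge0 ?ip_ge0.
have sC : cvgn s.
  apply: nondecreasing_is_cvgn; first exact/nondecreasing_seqP.
  by exists C => _ [n _ <-]; exact: bC.
have sle n : s n <= limn s.
  by apply: nondecreasing_cvgn_le => //; exact/nondecreasing_seqP.
have sd m n : (m <= n)%N ->
    ip mu (fun x => psum b n x - psum b m x) (fun x => psum b n x - psum b m x) =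
    s n - s m.
  move=> mn; rewrite (_ : (fun x => _) = fun x => \sum_(m <= k < n) b k * E k x).
    by rewrite ip_orthogonal_sum ?iota_uniq// /s [X in _ = X - _](@big_cat_nat _ _ _ m)//= addrAC subrr add0r.
  by apply/funext => x; rewrite /psum [X in X - _](@big_cat_nat _ _ _ m)//= addrAC subrr add0r.
have [|v [v2 vE vlim]] := L2_complete muT (psum_L2 b).
  move=> e e0; move/cvgrPdist_le : sC => /(_ _ e0)[N _ /(_ _ (leqnn N))/= sN].
  have main m n : (N <= m)%N -> (m <= n)%N -> s n - s m <= e.
    move=> Nm mn; rewrite (le_trans _ (le_trans (ler_norm _) sN))// lerB ?sle//.
    by have /nondecreasing_seqP := sS; apply.
  exists N => m n Nm Nn; have [mn|/ltnW nm] := leqP m n; last by rewrite sd ?main.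
  rewrite (_ : ip _ _ _ =
    ip mu (fun x => psum b n x - psum b m x) (fun x => psum b n x - psum b m x)).
    by rewrite sd ?main.
  by apply: eq_Rintegral => x _; ring.
exists v; split=> //.
- by move=> x y xy; apply: vE => n; apply: eq_bigr => k _; rewrite xy.
- by move=> h h2; apply: L2_cvg_ip => //; exact: psum_L2.
Qed.

Definition fcoef u n := ip mu u (E n) / ip mu (E n) (E n).

(** When [E n] has norm zero the quotient in [fcoef] is [0] and, by Cauchy-Schwarz,
    so is [(u, E n)]. *)
Lemma fcoefK u n : L2 mu u -> fcoef u n * ip mu (E n) (E n) = ip mu u (E n).
Proof.
move=> u2; have [N0|N0] := eqVneq (ip mu (E n) (E n)) 0; last by rewrite divfK.
rewrite N0 mulr0; apply/esym/eqP; rewrite -sqrf_eq0 eq_le sqr_ge0 andbT.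
by rewrite (le_trans (cauchy_schwarz u2 (E2 n)))// N0 mulr0.
Qed.

(** It is the nonnegativity of the squared norm of [u - psum (fcoef u) n]. *)
Lemma bessel u n : L2 mu u ->
  \sum_(0 <= k < n) fcoef u k ^+ 2 * ip mu (E k) (E k) <= ip mu u u.
Proof.
move=> u2; have S2 := psum_L2 (fcoef u) n.
have := ip_ge0 mu (fun x => 1 * u x - 1 * psum (fcoef u) n x).
rewrite ip_lincomb// [ip _ (psum _ _) (psum _ _)]ip_orthogonal_sum ?iota_uniq//.
rewrite [ip mu u (psum _ _)]ipC ip_psuml//.
rewrite (eq_bigr (fun k => fcoef u k ^+ 2 * ip mu (E k) (E k))).
  by move: (\sum_(_ <= _ < _) _) => p; lra.
by move=> k _; rewrite ipC -fcoefK//; ring.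
Qed.

(** The series converges to some [v] by Bessel's inequality; [u - v] is orthogonal
    to every [E m], hence zero almost everywhere by totality. *)
Lemma fourier_expansion u : (mu setT < +oo)%E ->
  (forall h, L2 mu h -> (forall n, ip mu h (E n) = 0) -> {ae mu, forall x, h x = 0}) ->
  L2 mu u -> forall h, L2 mu h ->
  (fun n => ip mu (psum (fcoef u) n) h) @ \oo --> ip mu u h.
Proof.
move=> muT Etot u2 h h2.
have [v [v2 _ vlim]] := orthogonal_series_cvg muT (fun n => bessel n u2).
rewrite (_ : ip mu u h = ip mu v h); first exact: vlim.
have uv2 : L2 mu (fun x => u x - v x) by exact: L2B.
apply: ae_eq_ip; [exact: L2_measurable u2|exact: L2_measurable v2|exact: L2_measurable h2|].
have : {ae mu, forall x, u x - v x = 0}.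
  apply: Etot => // m; rewrite ipBl//; apply/eqP; rewrite subr_eq0; apply/eqP.
  apply: (cvg_unique _ _ (vlim (E m) (E2 m))) => //.
  apply: (@cvg_near_cst _ _ _ _ \oo); exists m.+1 => // n /= mn.
  rewrite ip_psuml// (bigD1_seq m) ?iota_uniq ?mem_index_iota//= big1 ?addr0 ?fcoefK//.
  by move=> k km; rewrite Eorth ?mulr0.
by apply: filterS => x /eqP; rewrite subr_eq0 => /eqP.
Qed.
End orthogonal_series.

(** * Slicing the box *)

Section box_measure.
Variable R : realType.
Implicit Types n : nat.

Definition tail_fun (V : Type) n (a : 'I_n.+1 -> V) (i : 'I_n) : V := a (lift ord0 i).

Lemma tnth_cons0 n (t : measurableTypeR R) (y : Rpoint R n) :
  tnth (tuple_cons (t, y)) ord0 = t.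
Proof. by rewrite /tuple_cons/= tnth0. Qed.

Lemma tnth_consS n (t : measurableTypeR R) (y : Rpoint R n) i :
  tnth (tuple_cons (t, y)) (lift ord0 i) = tnth y i.
Proof. by rewrite /tuple_cons/= tnthS. Qed.

Lemma preimage_cons_box n (a L : 'I_n.+1 -> R) :
  @tuple_cons R n @^-1` box a L =
  `[a ord0, a ord0 + L ord0] `*` box (tail_fun a) (tail_fun L).
Proof.
apply/seteqP; split=> [[t y] H|[t y] [/= Ht Hy] i]; rewrite /box/=.
- split=> /=; first by have := H ord0; rewrite tnth_cons0.
  by move=> i; have := H (lift ord0 i); rewrite tnth_consS.
- have [->|[j ->]] : i = ord0 \/ exists j, i = lift ord0 j.
  + by case: (unliftP ord0 i) => [j ->|->]; [right; exists j|left].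
  + by rewrite tnth_cons0.
  + by rewrite tnth_consS; exact: Hy.
Qed.

Lemma itv_lty (a l : R) :
  (@lebesgue_measure R [set` `[a, (a + l)%R]] < +oo)%E.
Proof.
by rewrite lebesgue_measure_itv/=; case: ifP => // _; rewrite -EFinB ltry.
Qed.

Lemma lebesgue_tuple_box_lty n (a L : 'I_n -> R) :
  (lebesgue_tuple R n (box a L) < +oo)%E.
Proof.
elim: n a L => [|n IH] a L.
  by rewrite /= diracE; case: (_ \in _); rewrite ltry.
rewrite /= /lebesgue_cons /pushforward preimage_cons_box product_measure1E//; last first.
  exact: measurable_box.
apply: lte_mul_pinfty; [exact: measure_ge0| |exact: IH].
by rewrite ge0_fin_numE//; exact: itv_lty.
Qed.

Lemma mu_box_lty n (a L : 'I_n -> R) : (mu_box a L setT < +oo)%E.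
Proof. by rewrite /mu_box/= /mrestr setTI; exact: lebesgue_tuple_box_lty. Qed.

(** The same measure as [mu_box], packed with its finiteness so that product
    measures and Fubini's theorem apply. *)
Definition finite_box n (a L : 'I_n -> R) :
    {finite_measure set (Rpoint R n) -> \bar R} :=
  mfrestr (measurable_box a L) (lebesgue_tuple_box_lty a L).

Definition itv_measure (a l : R) :
    {finite_measure set (measurableTypeR R) -> \bar R} :=
  @mfrestr _ (measurableTypeR R) R _ lebesgue_measure
    (measurable_itv `[a, (a + l)%R]) (itv_lty a l).

Section slice.
Variables (n : nat) (a L : 'I_n.+1 -> R).
Let nu := itv_measure (a ord0) (L ord0).
Let mu' := finite_box (tail_fun a) (tail_fun L).
Let cons := @tuple_cons R n.

(** The measure of the box is an iterated product: this is the form in which the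
    inductions on the dimension use it. *)
Lemma mu_boxS A : measurable A ->
  mu_box a L A = pushforward (nu \x mu')%E cons A.
Proof.
move=> mA; rewrite /pushforward.
have mB : measurable (`[a ord0, a ord0 + L ord0]%classic `*`
    box (tail_fun a) (tail_fun L)) by apply: measurableX => //; exact: measurable_box.
transitivity (mrestr (lebesgue_measure \x lebesgue_tuple R n)%E mB (cons @^-1` A)).
  by rewrite /mu_box/= /mrestr /lebesgue_cons /pushforward preimage_setI preimage_cons_box.
apply/esym; apply: product_measure_unique.
- by move=> A1 A2 mA1 mA2; rewrite /= /mrestr -setXI product_measure1E//;
    apply: measurableI => //; exact: measurable_box.
- by rewrite -[X in measurable X]setTI; exact: measurable_tuple_cons.
Qed.

Lemma integrable_slice (f : Rpoint R n.+1 -> R) :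
  (mu_box a L).-integrable setT (EFin \o f) ->
  (nu \x mu')%E.-integrable setT (EFin \o (f \o cons)).
Proof.
move=> /integrableP[mf fi].
have mc := @measurable_tuple_cons R n.
apply/integrableP; split; first exact: (measurableT_comp mf mc).
move: fi; rewrite (eq_measure_integral (pushforward (nu \x mu')%E cons)).
- rewrite (ge0_integral_pushforward mc) ?preimage_setT//.
  exact: measurableT_comp.
- by move=> A mA _; exact: mu_boxS.
Qed.

Lemma integral_slice (f : Rpoint R n.+1 -> R) :
  (mu_box a L).-integrable setT (EFin \o f) ->
  (\int[mu_box a L]_x (f x)%:E = \int[(nu \x mu')]_z (f (cons z))%:E)%E.
Proof.
move=> fi; have mc := @measurable_tuple_cons R n.
rewrite (eq_measure_integral (pushforward (nu \x mu')%E cons)).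
- rewrite (integral_pushforward mc) ?preimage_setT//.
    exact: measurable_int fi.
  exact: integrable_slice.
- by move=> A mA _; exact: mu_boxS.
Qed.

End slice.
End box_measure.

(** * Integration against a restricted measure *)

(** The measure is the sum of its restrictions to [D] and to its complement, and
    the second does not see a function supported in [D]. *)
Lemma ge0_integral_mrestr d (T : measurableType d) (R : realType)
    (mu : {measure set T -> \bar R}) (D : set T) (mD : measurable D)
    (f : T -> \bar R) :
  measurable_fun setT f -> (forall x, 0 <= f x)%E ->
  (\int[mrestr mu mD]_x f x = \int[mu]_(x in D) f x)%E.
Proof.
move=> mf f0.
have mCD := measurableC mD.
have mfD : measurable_fun setT (f \_ D).
  by apply/(measurable_restrictT _ mD); exact: measurable_funTS.
have fD0 x : (0 <= (f \_ D) x)%E by rewrite patchE; case: ifP.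
rewrite [RHS]integral_mkcond.
rewrite [RHS](eq_measure_integral (measure_add (mrestr mu mD) (mrestr mu mCD))); last first.
  move=> A mA _; rewrite [RHS]measure_addE /= /mrestr -measureU; do ?exact: measurableI.
  - by rewrite -setIUr setUv setIT.
  - by rewrite setIACA setICr setI0.
rewrite ge0_integral_measure_add//.
rewrite [X in (_ = _ + X)%E](ae_eq_integral (cst 0%E))//; last first.
  exists D; split => //; first by rewrite /= /mrestr setICr measure0.
  by move=> x /= /not_implyP[_]; apply: contra_notP => Dx; rewrite patchE memNset.
rewrite integral0 adde0; apply: ae_eq_integral => //.
exists (~` D); split => //; first by rewrite /= /mrestr setICl measure0.
by move=> x /= /not_implyP[_]; apply: contra_not => Dx; rewrite patchE mem_set.
Qed.

Lemma integral_mrestr d (T : measurableType d) (R : realType)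
    (mu : {measure set T -> \bar R}) (D : set T) (mD : measurable D)
    (f : T -> \bar R) :
  measurable_fun setT f ->
  (\int[mrestr mu mD]_x f x = \int[mu]_(x in D) f x)%E.
Proof.
move=> mf; rewrite [LHS]integralE [RHS]integralE.
by rewrite !ge0_integral_mrestr//; [exact: measurable_funeneg|exact: measurable_funepos].
Qed.

Lemma integrable_mrestr d (T : measurableType d) (R : realType)
    (mu : {measure set T -> \bar R}) (D : set T) (mD : measurable D)
    (f : T -> \bar R) :
  measurable_fun setT f ->
  (mrestr mu mD).-integrable setT f <-> mu.-integrable D f.
Proof.
move=> mf; split=> /integrableP[_ fi]; apply/integrableP; split=> //.
- exact: measurable_funTS.
- by rewrite -ge0_integral_mrestr//; exact: measurableT_comp.
- by rewrite ge0_integral_mrestr//; exact: measurableT_comp.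
Qed.

(** * Functions with vanishing integrals over intervals *)

(** By Lebesgue's differentiation theorem [g] is almost everywhere the derivative
    of its integral, and that integral is constant. *)
Lemma ae0_of_integral_itv0 (R : realType) (g : R -> R) (a b : R) :
  measurable_fun setT g ->
  (@lebesgue_measure R).-integrable `[a, b] (EFin \o g) ->
  (forall p q, a <= p -> p < q -> q <= b ->
     \int[@lebesgue_measure R]_(x in `]p, q[) g x = 0) ->
  {ae @lebesgue_measure R, forall x, x \in `]a, b[ -> g x = 0}.
Proof.
move=> mg gi g0.
pose f := g \_ `[a, b].
have fi D : measurable D -> (@lebesgue_measure R).-integrable D (EFin \o f).
  move=> mD; apply: (@integrableS _ _ _ _ setT) => //.
  by rewrite /f -restrict_EFin; apply/(integrable_mkcond _ _).1.
have floc : locally_integrable setT f by exact: integrable_locally.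
have := FTC1 (a := BLeft a) (fun y => fi _ (measurable_itv _)) floc.
apply: filterS; first exact: (ae_filter_ringOfSetsType (@lebesgue_measure R)).
move=> x /= H; rewrite in_itv/= => /andP[ax xb].
have [|_] := H; first by rewrite lte_fin.
rewrite {2}/f patchE mem_set/= ?in_itv/= ?(ltW ax) ?(ltW xb)// => <-.
rewrite derive1E (@near_eq_derive _ _ _ _ (cst 0)).
  by rewrite derive_cst.
near=> y.
have ay : a < y by near: y; exact: lt_nbhsr.
have yb : y < b by near: y; exact: lt_nbhsl.
transitivity (\int[@lebesgue_measure R]_(t in `[a, y]) g t).
  apply: eq_Rintegral => t; rewrite inE/= in_itv/= => /andP[at_ ty].
  by rewrite /f patchE mem_set//= in_itv/= at_ (le_trans ty)// ltW.
rewrite -Rintegral_itv_obnd_cbnd; last first.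
  by apply: integrableS gi => //; apply: subset_itv; rewrite bnd_simp// ltW.
rewrite -Rintegral_itv_bndo_bndc; last first.
  by apply: integrableS gi => //; apply: subset_itv; rewrite bnd_simp// ltW.
by rewrite g0// ltW.
Unshelve. all: by end_near. Qed.

(** * Orthogonality to polynomials in a cosine *)

Lemma integrable_mul_bounded d (T : measurableType d) (R : realType)
    (mu : {measure set T -> \bar R}) (g h : T -> R) (M : R) :
  mu.-integrable setT (EFin \o g) -> measurable_fun setT h ->
  (forall x, `|h x| <= M) ->
  mu.-integrable setT (EFin \o (fun x => g x * h x)).
Proof.
move=> gi mh hM.
have -> : EFin \o (fun x => g x * h x) = ((EFin \o g) \* (EFin \o h))%E.
  by apply/funext => x /=; rewrite EFinM.
apply: integrableMl => //; exists M; split; first exact: num_real.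
by move=> y My x _; rewrite /= (le_trans (hM x))// ltW.
Qed.

(** The index [p] is a wave number together with a choice between cosine ([true])
    and sine ([false]).  Wave number [0] with a sine gives the zero function. *)
Definition mode1 (R : realType) (w : R) (p : nat * bool) (t : R) : R :=
  if p.2 then cos (p.1%:R * w * t) else sin (p.1%:R * w * t).

Lemma mode1_le1 (R : realType) (w : R) p t : `|mode1 w p t| <= 1.
Proof. by rewrite /mode1; case: p.2; [exact: cos_max|exact: sin_max]. Qed.

Lemma measurable_cos_affine (R : realType) (k c : R) :
  measurable_fun setT (fun t : measurableTypeR R => cos (k * t + c)).
Proof.
apply: continuous_measurable_fun => t.
by apply: continuous_comp; [apply: cvgD; [exact: mulrl_continuous|exact: cvg_cst]
  |exact: continuous_cos].
Qed.

Lemma measurable_mode1 (R : realType) (w : R) p :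
  measurable_fun setT (fun t : measurableTypeR R => mode1 w p t).
Proof.
rewrite /mode1; case: p.2.
  by have := measurable_cos_affine (p.1%:R * w) 0; under eq_fun do rewrite addr0.
have := measurable_cos_affine (p.1%:R * w) (- (pi / 2)).
by under eq_fun do rewrite cosBpihalf.
Qed.

Section trigonometric_polynomials.
Variable R : realType.
Variable mu : {measure set (measurableTypeR R) -> \bar R}.
Variables (w : R) (g : measurableTypeR R -> R).
Hypothesis gi : mu.-integrable setT (EFin \o g).
Hypothesis g0 : forall p, \int[mu]_t (g t * mode1 w p t) = 0.

(** A cosine with a phase is a combination of the cosine and the sine of the same
    wave number; negative wave numbers reduce to positive ones by parity. *)
Lemma integral_shifted_cos0 (k : int) c :
  \int[mu]_t (g t * cos (k%:~R * w * t + c)) = 0.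
Proof.
have main n b : \int[mu]_t (g t * cos (n%:R * w * t + b)) = 0.
  have i1 := integrable_mul_bounded gi (measurable_mode1 w (n, true)) (mode1_le1 w _).
  have i2 := integrable_mul_bounded gi (measurable_mode1 w (n, false)) (mode1_le1 w _).
  transitivity (\int[mu]_t (cos b * (g t * mode1 w (n, true) t) -
                            sin b * (g t * mode1 w (n, false) t))).
    by apply: eq_Rintegral => t _; rewrite cosD /mode1/=; ring.
  rewrite RintegralB//; last 2 first.
  - by under [X in _.-integrable _ X]eq_fun do rewrite /= EFinM; exact: integrableZl.
  - by under [X in _.-integrable _ X]eq_fun do rewrite /= EFinM; exact: integrableZl.
  by rewrite !RintegralZl// !g0 !mulr0 subr0.
case: k => n; first exact: main.
rewrite -(main n.+1 (- c)); apply: eq_Rintegral => t _; congr (_ * _).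
by rewrite -cosN NegzE mulrNz; congr cos; ring.
Qed.

Lemma horner_bounded (P : {poly R}) : exists M : R, forall y : R, `|y| <= 1 -> `|P.[y]| <= M.
Proof.
elim/poly_ind: P => [|P c [M IH]].
  by exists 0 => y _; rewrite horner0 normr0.
exists (M + `|c|) => y y1; rewrite !hornerE (le_trans (ler_normD _ _))// lerD2r.
rewrite normrM (le_trans (ler_piMr _ y1))// IH//.
Qed.

Lemma measurable_horner (P : {poly R}) d (T : measurableType d) (h : T -> R) :
  measurable_fun setT h -> measurable_fun setT (fun t => P.[h t]).
Proof.
move=> mh; elim/poly_ind: P => [|P c IH].
  by under eq_fun do rewrite horner0; exact: measurable_cst.
by under eq_fun do rewrite !hornerE; apply: measurable_funD => //;
  exact: measurable_funM.
Qed.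

(** Induction on [P] through the product-to-sum formula.  It goes through for the
    stronger claim in which an extra factor [cos (k w t + b)] is present, since
    multiplying by [cos (w t + c)] changes [k] and [b]. *)
Lemma integral_poly_cos0 (P : {poly R}) c :
  \int[mu]_t (g t * P.[cos (w * t + c)]) = 0.
Proof.
suff H : forall (k : int) b,
    \int[mu]_t (g t * (cos (k%:~R * w * t + b) * P.[cos (w * t + c)])) = 0.
  rewrite -(H 0 0); apply: eq_Rintegral => t _.
  by rewrite !mul0r addr0 cos0 mul1r.
elim/poly_ind: P => [|P e IH] k b.
  under eq_Rintegral do rewrite horner0 !mulr0.
  by rewrite Rintegral_cst// mul0r.
have [M HM] := horner_bounded P.
have iP (k' : int) b' : mu.-integrable setT
    (EFin \o (fun t => g t * (cos (k'%:~R * w * t + b') * P.[cos (w * t + c)]))).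
  apply: (integrable_mul_bounded (M := M)) => //.
    apply: measurable_funM; first exact: measurable_cos_affine.
    by apply: measurable_horner; exact: measurable_cos_affine.
  move=> t; rewrite normrM (le_trans (ler_piMl _ (cos_max _)))//.
  by apply: HM; exact: cos_max.
have ic : mu.-integrable setT (EFin \o (fun t => g t * cos (k%:~R * w * t + b))).
  apply: (integrable_mul_bounded (M := 1)) => //; first exact: measurable_cos_affine.
  by move=> t; exact: cos_max.
transitivity (\int[mu]_t (2^-1 * (g t * (cos ((k + 1)%:~R * w * t + (b + c)) * P.[cos (w * t + c)]) +
   g t * (cos ((k - 1)%:~R * w * t + (b - c)) * P.[cos (w * t + c)])) +
   e * (g t * cos (k%:~R * w * t + b)))).
  apply: eq_Rintegral => t _; rewrite hornerMXaddC.
  have -> : (k + 1)%:~R * w * t + (b + c) = (k%:~R * w * t + b) + (w * t + c).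
    by rewrite rmorphD/=; ring.
  have -> : (k - 1)%:~R * w * t + (b - c) = (k%:~R * w * t + b) - (w * t + c).
    by rewrite rmorphB/=; ring.
  by move: (k%:~R * w * t + b) (w * t + c) => u v; rewrite cosD cosB; field.
have iD := integrableD measurableT (iP (k + 1) (b + c)) (iP (k - 1) (b - c)).
rewrite RintegralD//; last 2 first.
- by under [X in _.-integrable _ X]eq_fun do rewrite /= EFinM EFinD; exact: integrableZl.
- by under [X in _.-integrable _ X]eq_fun do rewrite /= EFinM; exact: integrableZl.
rewrite !RintegralZl// RintegralD//.
by rewrite !IH integral_shifted_cos0 addr0 !mulr0 addr0.
Qed.
End trigonometric_polynomials.

(** * Polynomial approximation of a step *)

Section step_approximation.
Variable R : realType.

Lemma bernoulli_ineq (x : R) n : 0 <= x -> 1 + n%:R * x <= (1 + x) ^+ n.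
Proof.
move=> x0; elim: n => [|n IH]; first by rewrite mul0r addr0 expr0.
rewrite exprSr; apply: le_trans (ler_wpM2r _ IH); last by rewrite addr_ge0.
have : 0 <= n%:R * x * x by rewrite !mulr_ge0.
by rewrite -natr1; lra.
Qed.

Lemma bernoulli_ineqN (x : R) n : 0 <= x <= 1 -> 1 - n%:R * x <= (1 - x) ^+ n.
Proof.
move=> /andP[x0 x1]; elim: n => [|n IH]; first by rewrite mul0r subr0 expr0.
rewrite exprSr; apply: le_trans (ler_wpM2r _ IH); last by rewrite subr_ge0.
have : 0 <= n%:R * x * x by rewrite !mulr_ge0.
by rewrite -natr1; lra.
Qed.

(** This is [(1 - u)^n (1 + u)^n <= 1] combined with Bernoulli's inequality; it makes
    powers of [1 - u] decay like [1 / (n u)] with no logarithm involved. *)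
Lemma onem_expr_le (u : R) n : 0 <= u <= 1 -> (1 - u) ^+ n * (1 + n%:R * u) <= 1.
Proof.
move=> /andP[u0 u1].
apply: (@le_trans _ _ ((1 - u) ^+ n * (1 + u) ^+ n)).
  by rewrite ler_wpM2l ?exprn_ge0 ?subr_ge0// bernoulli_ineq.
rewrite -exprMn exprn_ile1//.
  by rewrite mulr_ge0 ?subr_ge0// addr_ge0.
by have := mulr_ge0 u0 u0; lra.
Qed.

Lemma harmonic_le (e : R) : 0 < e -> exists m, forall k, (m <= k)%N -> (k.+1%:R)^-1 <= e.
Proof.
move=> e0; have := @cvg_harmonic R => /cvgrPdist_le /(_ _ e0)[m _ Hm]; exists m => k mk.
by have := Hm k mk; rewrite /= sub0r normrN ger0_norm ?invr_ge0.
Qed.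

(** With [n = (m + 1)^2], the polynomial [1 - (1 - x^n)^(2^n)] is close to [0] for
    [x] below [1/2] and close to [1] for [x] above [1/2].  The argument
    [x = 1/2 + (y - s - 1/(m + 1)) / 8] stays in [0, 1] for [y] and [s] in [-1, 1].
    The shift [1/(m + 1)] puts [y = s] on the lower side, and the exponent
    [(m + 1)^2] is large enough for it to matter. *)
Definition step_poly (s : R) (m : nat) : {poly R} :=
  let x := (8^-1)%:P * 'X + (2^-1 - (s + m.+1%:R^-1) / 8)%:P in
  1 - (1 - x ^+ (m.+1 ^ 2)) ^+ (2 ^ (m.+1 ^ 2)).

Definition step_arg (s y : R) m : R := 1 + (y - s - m.+1%:R^-1) / 4.

Lemma step_polyE s m y : (step_poly s m).[y] =
  1 - (1 - (step_arg s y m / 2) ^+ (m.+1 ^ 2)) ^+ (2 ^ (m.+1 ^ 2)).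
Proof.
have -> : step_arg s y m / 2 = 8^-1 * y + (2^-1 - (s + m.+1%:R^-1) / 8) by rewrite /step_arg; field.
by rewrite /step_poly hornerD hornerN hornerC horner_exp hornerD hornerN hornerC
  horner_exp hornerD hornerM hornerX !hornerC.
Qed.

Lemma step_arg_bounds s y m : `|s| <= 1 -> `|y| <= 1 -> 0 <= step_arg s y m / 2 <= 1.
Proof.
rewrite !ler_norml => /andP[s0 s1] /andP[y0 y1].
have m0 : 0 <= m.+1%:R^-1 :> R by rewrite invr_ge0.
have m1 : m.+1%:R^-1 <= 1 :> R by rewrite invf_le1// ler1n.
by rewrite /step_arg; move: (m.+1%:R^-1) m0 m1 => q m0 m1; apply/andP; split; lra.
Qed.

Lemma step_poly01 s m y : `|s| <= 1 -> `|y| <= 1 -> 0 <= (step_poly s m).[y] <= 1.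
Proof.
move=> s1 y1; rewrite step_polyE; have /andP[z0 z1] := step_arg_bounds m s1 y1.
have h0 : 0 <= (step_arg s y m / 2) ^+ (m.+1 ^ 2) by rewrite exprn_ge0.
have h1 : (step_arg s y m / 2) ^+ (m.+1 ^ 2) <= 1 by rewrite exprn_ile1.
set u := _ ^+ (m.+1 ^ 2) in h0 h1 *; set N := (2 ^ _)%N.
have h2 : 0 <= (1 - u) ^+ N by rewrite exprn_ge0 ?subr_ge0.
have h3 : (1 - u) ^+ N <= 1 by rewrite exprn_ile1 ?subr_ge0// gerBl.
by apply/andP; split; lra.
Qed.

Lemma step_poly_cvg s y : `|s| <= 1 -> `|y| <= 1 ->
  (step_poly s m).[y] @[m --> \oo] --> ((s < y)%R%:R : R).
Proof.
move=> s1 y1; apply/cvgrPdist_le => e e0.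
have zE m : 2 ^+ (m.+1 ^ 2) * (step_arg s y m / 2) ^+ (m.+1 ^ 2) = step_arg s y m ^+ (m.+1 ^ 2).
  by rewrite -exprMn; congr (_ ^+ _); field.
have m0 m : 0 < m.+1%:R^-1 :> R by rewrite invr_gt0.
have [sy|ys] := ltP s y.
- (* here [step_arg s y m] stays above [1 + (y - s) / 8], so [N * u] grows
     faster than [m], which [onem_expr_le] turns into decay of [(1 - u)^N] *)
  have [m1 Hm1] := harmonic_le (e := (y - s) / 2) (ltac:(lra)).
  have [m2 Hm2] := harmonic_le (e := e * ((y - s) / 8)) (ltac:(nra)).
  exists (maxn m1 m2) => // m /=; rewrite geq_max => /andP[/Hm1 h1 /Hm2 h2].
  have /andP[z0 z1] := step_arg_bounds m s1 y1.
  rewrite step_polyE; set u := (step_arg s y m / 2) ^+ _.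
  have u0 : 0 <= u by rewrite exprn_ge0.
  have u1 : u <= 1 by rewrite exprn_ile1.
  set N := (2 ^ (m.+1 ^ 2))%N.
  have -> : 1 - (1 - (1 - u) ^+ N) = (1 - u) ^+ N by ring.
  rewrite ger0_norm ?exprn_ge0 ?subr_ge0//.
  have uu := @onem_expr_le u N (ltac:(by rewrite u0 u1)).
  have v0 : 0 <= (1 - u) ^+ N by rewrite exprn_ge0 ?subr_ge0.
  have : m.+1%:R * ((y - s) / 8) <= N%:R * u.
    rewrite /N natrX zE (le_trans _ (lerXn2r _ _ _ (_ : 1 + (y - s) / 8 <= _)))//; last first.
    + by rewrite /step_arg; move: (m.+1%:R^-1) h1 => q h1; lra.
    + by rewrite nnegrE; have := z0; lra.
    + by rewrite nnegrE; lra.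
    rewrite (le_trans _ (bernoulli_ineq _ _))//; last by lra.
    have : m.+1%:R <= (m.+1 ^ 2)%:R :> R by rewrite ler_nat leq_pmull.
    by move: (m.+1%:R) ((m.+1 ^ 2)%:R) => p q pq; nra.
  rewrite -(@ler_pM2r _ (m.+1%:R^-1))// mulrAC divff ?mul1r ?pnatr_eq0//.
  move: uu v0 h2 (m0 m) e0; move: ((1 - u) ^+ N) (N%:R * u) (m.+1%:R^-1) => v p q.
  move=> uu v0 h2 q0 e0 hp.
  have d0 : 0 < (y - s) / 8 by lra.
  rewrite -(@ler_pM2r _ ((y - s) / 8))//; apply: le_trans h2.
  apply: (@le_trans _ _ (v * (p * q))); first by rewrite ler_wpM2l.
  by rewrite mulrA ler_piMl// ?ltW//; nra.
- (* here [step_arg s y m] stays below [1 - 1 / (4 (m + 1))], whose power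
     [(m + 1)^2] tends to zero *)
  have [m1 Hm1] := harmonic_le (e := e / 4) (ltac:(lra)).
  exists m1 => // m /= /Hm1 h1.
  have /andP[z0 z1] := step_arg_bounds m s1 y1.
  have /andP[q0 q1] := step_poly01 m s1 y1.
  rewrite sub0r normrN ger0_norm// step_polyE.
  set u := (step_arg s y m / 2) ^+ _.
  have u0 : 0 <= u by rewrite exprn_ge0.
  have u1 : u <= 1 by rewrite exprn_ile1.
  have := @bernoulli_ineqN u (2 ^ (m.+1 ^ 2)) (ltac:(by rewrite u0 u1)).
  rewrite natrX zE => H.
  apply: (@le_trans _ _ (step_arg s y m ^+ (m.+1 ^ 2))); first by move: H; lra.
  apply: (@le_trans _ _ ((1 - m.+1%:R^-1 / 4) ^+ (m.+1 ^ 2))).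
    rewrite lerXn2r ?nnegrE//; [by move: z0; lra| |by rewrite /step_arg; move: (m.+1%:R^-1) => q; lra].
    have : m.+1%:R^-1 <= 1 :> R by rewrite invf_le1// ler1n.
    by move: (m.+1%:R^-1) => q; lra.
  have := @onem_expr_le (m.+1%:R^-1 / 4) (m.+1 ^ 2).
  have -> : (m.+1 ^ 2)%:R * (m.+1%:R^-1 / 4) = m.+1%:R / 4 :> R.
    have pn0 : m.+1%:R != 0 :> R by rewrite pnatr_eq0.
    by rewrite natrX; move: (m.+1%:R) pn0 => p pn0; field.
  have d1 : m.+1%:R^-1 <= 1 :> R by rewrite invf_le1// ler1n.
  have c0 : 0 <= 1 - m.+1%:R^-1 / 4 :> R by move: (m.+1%:R^-1) d1 => q d1; lra.
  have c1 : 0 <= (m.+1%:R^-1 / 4 : R) <= 1.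
    have := m0 m; move: (m.+1%:R^-1) d1 => q d1 d0.
    by apply/andP; split; lra.
  move=> /(_ c1); have := exprn_ge0 (m.+1 ^ 2) c0.
  move: (_ ^+ _) => v v0 hv; apply: (@le_trans _ _ (4 * m.+1%:R^-1)); last first.
    by move: (m.+1%:R^-1) h1 => q h1; lra.
  rewrite ler_pdivlMr//.
  by move: (m.+1%:R) hv (ltr0Sn R m) => p; nra.
Qed.
End step_approximation.

(** * Totality of the trigonometric system on an interval *)

Section interval_total.
Variable R : realType.

(** The cosine decreases with the distance to its maximum, measured along a circle
    of length [l]; so an arc, here of half-length [(q - p) / 2] around
    [(p + q) / 2], is one of its superlevel sets. *)
Lemma arc_cos (a l p q t : R) : 0 < l -> a <= p -> p < q -> q <= a + l ->
  a <= t <= a + l ->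
  (cos (2 * pi / l * ((q - p) / 2)) < cos (2 * pi / l * (t - (p + q) / 2))) =
  (p < t < q).
Proof.
move=> l0 ap pq ql /andP[at_ tl].
set w := 2 * pi / l; set c := (p + q) / 2; set h := (q - p) / 2.
have w0 : 0 < w by rewrite /w divr_gt0// mulr_gt0// pi_gt0.
have wl : w * l = 2 * pi by rewrite /w divfK// gt_eqF.
have h0 : 0 < h by rewrite /h; lra.
have hl : h <= l / 2 by rewrite /h; lra.
have tch : `|t - c| <= l - h by rewrite ler_norml /c /h; apply/andP; split; lra.
have -> : (p < t < q) = (`|t - c| < h).
  by rewrite ltr_norml /c /h; apply/andP/andP => -[]; split; lra.
rewrite -[X in _ < X]cos_norm normrM (gtr0_norm w0).
set th := w * `|t - c|; set et := w * h.
have -> : (`|t - c| < h) = (th < et) by rewrite /th /et ltr_pM2l.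
have th0 : 0 <= th by rewrite /th mulr_ge0// ltW.
have et0 : 0 < et by rewrite /et mulr_gt0.
have etpi : et <= pi.
  have : w * h <= w * (l / 2) by rewrite ler_pM2l.
  by rewrite /et mulrA wl; lra.
have thl : th <= 2 * pi - et.
  have : w * `|t - c| <= w * (l - h) by rewrite ler_pM2l.
  by rewrite mulrBr wl.
have [thpi|pith] := leP th pi.
  by rewrite ltr_cos// in_itv/= ?th0 ?(ltW et0).
have -> : (th < et) = false by apply/negbTE; rewrite -leNgt; lra.
apply/negbTE; rewrite -leNgt -[cos th]cosN.
have -> : cos (- th) = cos (2 * pi - th).
  by rewrite -[LHS]cosD2pi; congr cos; rewrite mulr2n; ring.
rewrite leNgt ltr_cos ?in_itv/=.
- by rewrite -leNgt; lra.
- by apply/andP; split; lra.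
- by apply/andP; split; lra.
Qed.

(** Indicators of intervals are bounded limits of polynomials in a shifted cosine,
    to which [g] is orthogonal; by dominated convergence the integral of [g] over
    every interval vanishes. *)
Lemma total_mode1 (a l : R) (g : measurableTypeR R -> R) : 0 < l ->
  measurable_fun setT g ->
  (itv_measure a l).-integrable setT (EFin \o g) ->
  (forall p, \int[itv_measure a l]_t (g t * mode1 (2 * pi / l) p t) = 0) ->
  {ae itv_measure a l, forall t, g t = 0}.
Proof.
move=> l0 mg gi g0; set nu := itv_measure a l.
have gil : (@lebesgue_measure R).-integrable `[a, a + l] (EFin \o g).
  by apply/(integrable_mrestr lebesgue_measure (measurable_itv `[a, a + l])) => //;
    exact/measurable_EFinP.
have ae_nu P : {ae @lebesgue_measure R, forall t, P t} -> {ae nu, forall t, P t}.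
  move=> [N [mN N0 PN]]; exists N; split => //.
  apply/eqP; rewrite eq_le measure_ge0 andbT -N0 /nu /itv_measure/= /mfrestr /mrestr.
  by apply: le_measure; rewrite ?inE//; apply: measurableI.
have itv0 p q : a <= p -> p < q -> q <= a + l ->
    \int[@lebesgue_measure R]_(t in `]p, q[) g t = 0.
  move=> ap pq ql.
  pose w := 2 * pi / l; pose s := cos (w * ((q - p) / 2)).
  pose y (t : measurableTypeR R) : R := cos (w * t + - (w * ((p + q) / 2))).
  have my : measurable_fun setT y by exact: measurable_cos_affine.
  have s1 : `|s| <= 1 by exact: cos_max.
  have y1 t : `|y t| <= 1 by exact: cos_max.
  have mlt : measurable_fun setT (fun t => (s < y t)%R%:R : R).
    rewrite (_ : (fun t => _) = \1_(y @^-1` `]s, +oo[)).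
      by apply: measurable_indic; rewrite -[X in measurable X]setTI; exact: my.
    apply/funext => t; rewrite indicE; congr (_%:R); congr (nat_of_bool _).
    by apply/idP/idP; rewrite inE/= in_itv/= andbT.
  have -> : \int[@lebesgue_measure R]_(t in `]p, q[) g t =
      \int[nu]_t (g t * (s < y t)%R%:R).
    rewrite /Rintegral integral_mrestr; last first.
      by apply/measurable_EFinP; exact: measurable_funM.
    rewrite integral_mkcond [in RHS]integral_mkcond; congr fine.
    apply: eq_integral => t _; rewrite !patchE.
    have [tI|tI] := boolP (t \in `[a, a + l]%classic); last first.
      rewrite ifF//; apply: contraNF tI; rewrite !inE/= !in_itv/= => /andP[pt tq].
      by apply/andP; split; lra.
    move: tI; rewrite inE/= in_itv/= => tI.
    have -> : (s < y t) = (p < t < q).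
      by rewrite -(arc_cos l0 ap pq ql tI) /s /y mulrBr.
    have [ptq|ptq] := boolP (p < t < q); first by rewrite mem_set/= ?in_itv// mulr1.
    by rewrite memNset ?mulr0//= in_itv/=; exact/negP.
  pose F m t := (g t * (step_poly s m).[y t])%:E.
  have FE m : (\int[nu]_t F m t = 0)%E.
    have i : nu.-integrable setT (F m).
      apply: (integrable_mul_bounded (M := 1)) => //.
        by apply: measurable_horner.
      by move=> t; have /andP[x0 x1] := step_poly01 m s1 (y1 t); rewrite ger0_norm.
    rewrite -(@fineK _ (\int[nu]_t F m t)%E); last exact: integrable_fin_num.
    by congr EFin; exact: (integral_poly_cos0 gi g0).
  have [] := @dominated_convergence _ _ _ nu setT measurableT F
     (fun t => (g t * (s < y t)%R%:R)%:E) (fun t => `|(g t)%:E|)%E.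
  - move=> m; apply/measurable_EFinP; apply: measurable_funM => //.
    exact: measurable_horner.
  - by apply/measurable_EFinP; exact: measurable_funM.
  - apply: aeW => t _; apply: cvg_EFin; first exact: nearW.
    by apply: cvgM; [exact: cvg_cst|exact: step_poly_cvg].
  - exact: integrable_abse.
  - apply: aeW => t m _; rewrite /F/= lee_fin normrM ler_piMr//.
    by have /andP[x0 x1] := step_poly01 m s1 (y1 t); rewrite ger0_norm.
  move=> _ _; rewrite (_ : (fun m => _) = cst 0%E); last by apply/funext => m; exact: FE.
  move=> /(cvg_unique _ (cvg_cst 0%E)) h.
  by rewrite /Rintegral -h.
have := ae0_of_integral_itv0 mg gil itv0 => /ae_nu.
have ta : {ae nu, forall t : measurableTypeR R, t <> a}.
  apply: ae_nu; exists [set a]; split; [exact: measurable_set1|exact: lebesgue_measure_set1|].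
  by move=> t /= /contrapT.
have tb : {ae nu, forall t : measurableTypeR R, t <> a + l}.
  apply: ae_nu; exists [set a + l]; split; [exact: measurable_set1|exact: lebesgue_measure_set1|].
  by move=> t /= /contrapT.
have tI : {ae nu, forall t : measurableTypeR R, a <= t <= a + l}.
  exists (~` `[a, a + l]%classic); split.
  - by apply: measurableC; exact: measurable_itv.
  - by rewrite /nu /itv_measure/= /mfrestr /mrestr setICl measure0.
  - by move=> t /=; rewrite in_itv/=.
have AF := ae_filter_ringOfSetsType nu.
move=> gae; have := @filterI _ _ AF _ _ (@filterI _ _ AF _ _ ta tb) (@filterI _ _ AF _ _ tI gae).
apply: (@filterS _ _ AF) => t [[/eqP ta' /eqP tb'] [/andP[at_ tl]]]; apply.
by rewrite in_itv/= !lt_neqAle at_ tl tb' eq_sym ta'.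
Qed.
End interval_total.

(** * Totality of the trigonometric system on the box *)

Section modes.
Variable R : realType.

Definition mode n (w : 'I_n -> R) (k : 'I_n -> nat * bool) (x : 'I_n -> R) : R :=
  \prod_i mode1 (w i) (k i) (x i).

Lemma mode_le1 n (w : 'I_n -> R) k x : `|mode w k x| <= 1.
Proof.
rewrite /mode normr_prod; apply: prodr_ile1 => i _.
by rewrite normr_ge0 mode1_le1.
Qed.

Lemma measurable_mode n (w : 'I_n -> R) k :
  measurable_fun setT (fun x : Rpoint R n => mode w k (tnth x)).
Proof.
rewrite /mode; apply: measurable_prod => i _.
by apply: measurableT_comp; [exact: measurable_mode1|exact: measurable_tnth].
Qed.

Definition freq n (L : 'I_n -> R) i := 2 * pi / L i.

(** Fix the index [k] of the last [n] variables.  Integrating [f] against the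
    corresponding mode leaves a function [G k] of the first variable, orthogonal to
    all one-dimensional modes and hence zero almost everywhere.  So for almost every
    value of the first variable the slice of [f] is orthogonal to all modes in [n]
    variables, and the induction hypothesis applies to it. *)
Lemma total_modes n (a L : 'I_n -> R) (f : Rpoint R n -> R) :
  (forall i, 0 < L i) -> (mu_box a L).-integrable setT (EFin \o f) ->
  (forall k : {ffun 'I_n -> nat * bool},
     \int[mu_box a L]_x (f x * mode (freq L) k (tnth x)) = 0) ->
  {ae mu_box a L, forall x, f x = 0}.
Proof.
elim: n a L f => [|n IH] a L f hL fi f0.
  (* the space has one point, and the empty product is the only mode *)
  have := f0 [ffun=> (0, true)].
  rewrite (_ : (fun x => _) = cst (f [tuple])); last first.
    by apply/funext => x; rewrite /mode big_ord0 mulr1 (tuple0 x).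
  have mu1 : mu_box a L setT = 1%E.
    by rewrite /mu_box/= /mrestr setTI /dirac indicE mem_set//; case.
  rewrite Rintegral_cst// [X in fine X]mu1 mulr1 => f00; exists set0; split => //.
  by rewrite subset0 -subset0 => x /=; rewrite (tuple0 x).
pose nu := itv_measure (a ord0) (L ord0).
pose mu' := finite_box (tail_fun a) (tail_fun L).
pose c := @tuple_cons R n.
have ci := integrable_slice fi.
have mc : measurable_fun setT (f \o c) by apply/measurable_EFinP; exact: measurable_int ci.
have w'E : freq (tail_fun L) = tail_fun (freq L) by [].
pose h (k : {ffun 'I_n -> nat * bool}) z := f (c z) * mode (freq (tail_fun L)) k (tnth z.2).
have hi k : (nu \x mu')%E.-integrable setT (EFin \o h k).
  apply: (integrable_mul_bounded (M := 1)) => //.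
    exact: (measurableT_comp (measurable_mode _ _)).
  by move=> z; exact: mode_le1.
pose G k t := fine (fubini_F mu' (EFin \o h k) t).
have Fi k := integrable_fubini_F (hi k).
have mG k : measurable_fun setT (G k).
  by apply: measurableT_comp; [exact: fine_measurable|exact: measurable_int (Fi k)].
have GE k : {ae nu, forall t, (G k t)%:E = fubini_F mu' (EFin \o h k) t}.
  have := integrable_ae measurableT (Fi k); apply: filterS => t /(_ I) Ft.
  by rewrite fineK.
have Gi k : nu.-integrable setT (EFin \o G k).
  apply: (le_integrable measurableT (g := fubini_F mu' (EFin \o h k))) => //.
    exact/measurable_EFinP.
  by move=> t _; rewrite /G/=; case: (fubini_F _ _ t) => //=; rewrite normr0 ?leey.
have G0 k : {ae nu, forall t, G k t = 0}.
  apply: total_mode1 => // p.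
  pose k' : {ffun 'I_n.+1 -> nat * bool} := [ffun i => oapp k p (unlift ord0 i)].
  have := f0 k'; rewrite /Rintegral integral_slice; last first.
    apply: (integrable_mul_bounded (M := 1)) => //; first exact: measurable_mode.
    by move=> x; exact: mode_le1.
  have modeE z : mode (freq L) k' (tnth (c z)) =
      mode1 (freq L ord0) p z.1 * mode (freq (tail_fun L)) k (tnth z.2).
    case: z => t y; rewrite /mode big_ord_recl /c tnth_cons0 ffunE unlift_none/=.
    by congr (_ * _); apply: eq_bigr => i _; rewrite tnth_consS ffunE liftK.
  rewrite (eq_integral (EFin \o (fun z => h k z * mode1 (freq L ord0) p z.1))); last first.
    by move=> z _; rewrite -/c modeE /h/=; congr EFin; ring.
  have i2 : (nu \x mu')%E.-integrable setT
      (EFin \o (fun z => h k z * mode1 (freq L ord0) p z.1)).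
    apply: (integrable_mul_bounded (M := 1)) => //.
      exact: (measurableT_comp (measurable_mode1 _ _)).
    by move=> z; exact: mode1_le1.
  rewrite -integral12_prod_meas1// => <-; congr fine; apply: ae_eq_integral => //.
  - apply/measurable_EFinP; apply: measurable_funM => //; exact: measurable_mode1.
  - exact: (measurable_fubini_F i2).
  move: (ae_integrable1 (hi k)) (GE k); apply: filterS2 => t hti Gt _; rewrite /fubini_F/= EFinM Gt /fubini_F.
  by under [RHS]eq_integral do rewrite EFinM; rewrite integralZr.
have Gall : {ae nu, forall t, forall k, G k t = 0}.
  have : {ae nu, forall t, forall m, if unpickle m is Some k then G k t = 0 else True}.
    apply: ae_foralln => m; case: (unpickle m) => [k|]; [exact: G0|exact: aeW].
  by apply: filterS => t Ht k; have := Ht (pickle k); rewrite pickleK.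
have slice0 : {ae nu, forall t, (\int[mu']_y `|(f (c (t, y)))%:E| = 0)%E}.
  have GallE : {ae nu, forall t, forall k, (G k t)%:E = fubini_F mu' (EFin \o h k) t}.
    have : {ae nu, forall t, forall m, if unpickle m is Some k then
        (G k t)%:E = fubini_F mu' (EFin \o h k) t else True}.
      apply: ae_foralln => m; case: (unpickle m) => [k|]; [exact: GE|exact: aeW].
    by apply: filterS => t Ht k; have := Ht (pickle k); rewrite pickleK.
  move: (ae_integrable1 ci) Gall GallE; apply: filterS3 => t ti Gt GtE.
  have /(ae_eq_integral_abs mu' measurableT (measurable_int _ ti)) -> // : 
    {ae mu', forall y, setT y -> (EFin \o (f \o c)) (t, y) = 0%E}.
  have := IH (tail_fun a) (tail_fun L) (fun y => f (c (t, y))) _ ti.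
  have H1 : forall i, 0 < tail_fun L i by move=> i; exact: hL.
  move=> /(_ H1) H2; apply: filterS (H2 _); first by move=> y /= ->.
  by move=> k; rewrite -(Gt k).
have f00 : (\int[mu_box a L]_x `|(EFin \o f) x| = 0)%E.
  rewrite (eq_integral (fun x => (`|f x|)%:E))//.
  have ni : (mu_box a L).-integrable setT (EFin \o (fun x => `|f x|)).
    exact: integrable_abse fi.
  rewrite (integral_slice ni) -(integral12_prod_meas1 (integrable_slice ni)).
  rewrite (ae_eq_integral (cst 0%E)) ?integral0//.
    exact: (measurable_fubini_F (integrable_slice ni)).
  by apply: filterS slice0 => t Ht _.
have := (ae_eq_integral_abs _ measurableT (measurable_int _ fi)).1 f00.
by apply: filterS => x /(_ I)/= [].
Qed.
End modes.

(** * Integrals vanishing along a coordinate *)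

Section slice0.
Variable R : realType.

Definition upd n (x : Rpoint R n) (i : 'I_n) (t : R) : Rpoint R n :=
  [tuple if j == i then t else tnth x j | j < n].

Lemma tnth_upd n (x : Rpoint R n) i t j :
  tnth (upd x i t) j = if j == i then t else tnth x j.
Proof. by rewrite tnth_mktuple. Qed.

Lemma upd_cons0 n (s t : measurableTypeR R) (y : Rpoint R n) :
  upd (tuple_cons (s, y)) ord0 t = tuple_cons (t, y).
Proof.
apply/eq_from_tnth => j; rewrite tnth_upd; case: (unliftP ord0 j) => [k ->|->].
  by rewrite !tnth_consS.
by rewrite eqxx tnth_cons0.
Qed.

Lemma upd_consS n (s t : measurableTypeR R) (y : Rpoint R n) i :
  upd (tuple_cons (s, y)) (lift ord0 i) t = tuple_cons (s, upd y i t).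
Proof.
apply/eq_from_tnth => j; rewrite tnth_upd; case: (unliftP ord0 j) => [k ->|->].
  by rewrite !tnth_consS tnth_upd (inj_eq (@lift_inj _ ord0)).
by rewrite (negbTE (neq_lift _ _)) !tnth_cons0.
Qed.

Lemma bounded_integrable d (T : measurableType d) (mu : {measure set T -> \bar R})
    (f : T -> R) (M : R) : (mu setT < +oo)%E -> measurable_fun setT f ->
  (forall x, `|f x| <= M) -> mu.-integrable setT (EFin \o f).
Proof.
move=> muT mf fM.
rewrite (_ : EFin \o f = EFin \o (fun x => 1 * f x)).
  by apply: integrable_mul_bounded fM => //; exact: integrable_cstr.
by apply/funext => x /=; rewrite mul1r.
Qed.

Lemma bounded_Rintegral0 d (T : measurableType d) (mu : {measure set T -> \bar R})
    (f : T -> R) (M : R) : (mu setT < +oo)%E -> measurable_fun setT f ->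
  (forall x, `|f x| <= M) -> \int[mu]_x f x = 0 -> (\int[mu]_x (f x)%:E = 0)%E.
Proof.
move=> muT mf fM f0; rewrite -(@fineK _ (\int[mu]_x (f x)%:E)%E).
  by rewrite [fine _]f0.
by apply: integrable_fin_num => //; exact: bounded_integrable fM.
Qed.

Lemma finite_setT_lty d (T : measurableType d) (mu : {finite_measure set T -> \bar R}) :
  (mu setT < +oo)%E.
Proof. by rewrite -ge0_fin_numE// fin_num_measure. Qed.

(** Fubini's theorem, brought to the [i]-th coordinate by peeling off the first one
    again and again.  Orthogonality of modes and integration by parts are both
    reduced to one variable by it. *)
Lemma integral_box_slice0 n (a L : 'I_n -> R) (f : Rpoint R n -> R) i (M : R) :
  measurable_fun setT f -> (forall x, `|f x| <= M) ->
  (forall x, \int[itv_measure (a i) (L i)]_t f (upd x i t) = 0) ->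
  \int[mu_box a L]_x f x = 0.
Proof.
elim: n a L f i => [a L f []//|n IH] a L f i mf fM f0.
have fi : (mu_box a L).-integrable setT (EFin \o f).
  by apply: bounded_integrable fM => //; exact: mu_box_lty.
rewrite /Rintegral (integral_slice fi).
have mc : measurable_fun setT (f \o @tuple_cons R n).
  by apply: measurableT_comp => //; exact: measurable_tuple_cons.
have m1 (t : measurableTypeR R) : measurable_fun setT (fun y => f (tuple_cons (t, y))).
  exact: measurableT_comp mc (measurable_pair1 _).
have m2 (y : Rpoint R n) : measurable_fun setT (fun t => f (tuple_cons (t, y))).
  exact: measurableT_comp mc (measurable_pair2 _).
case: (unliftP ord0 i) f0 => [j ->|->] f0.
- rewrite -(integral12_prod_meas1 (integrable_slice fi)).
  under eq_integral => t _.
    rewrite /fubini_F (bounded_Rintegral0 (finite_setT_lty _) (m1 t) (M := M))//; last first.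
      apply: (IH (tail_fun a) (tail_fun L) (fun y => f (tuple_cons (t, y))) j) => //.
      by move=> y; under eq_Rintegral do rewrite -upd_consS; exact: f0.
    over.
  by rewrite integral0.
- rewrite -(integral21_prod_meas1 (integrable_slice fi)).
  under eq_integral => y _.
    rewrite /fubini_G (bounded_Rintegral0 (finite_setT_lty _) (m2 y) (M := M))//; last first.
      rewrite -[RHS](f0 (tuple_cons (0, y))).
      by apply: eq_Rintegral => t _; rewrite upd_cons0.
    over.
  by rewrite integral0.
Qed.
End slice0.

(** * Trigonometric functions of one variable *)

Section modes_1d.
Variable R : realType.
Implicit Types (w a l : R) (p q : nat * bool).

(** With [flip], it expresses differentiation inside the trigonometric system: the
    derivative of [mode1 w p] is [dcoef w p] times [mode1 w (flip p)]. *)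
Definition dcoef w p : R := (if p.2 then -1 else 1) * (p.1%:R * w).

Definition flip p : nat * bool := (p.1, ~~ p.2).

Lemma flip_of_neq p q : p.1 = q.1 -> p != q -> q = flip p.
Proof.
case: p q => n b [m c] /= ->.
by rewrite xpair_eqE eqxx /flip/=; case: b; case: c.
Qed.

Lemma dcoef_flip w p : dcoef w p * dcoef w (flip p) = - (p.1%:R * w) ^+ 2.
Proof. by rewrite /dcoef /flip/=; case: p.2 => /=; ring. Qed.

Lemma dcoef_neq0 w p : w != 0 -> p.1 != 0 -> dcoef w p != 0.
Proof.
move=> w0 p0; apply: mulf_neq0; last by apply: mulf_neq0; rewrite ?pnatr_eq0.
by case: p.2; rewrite ?oppr_eq0 oner_neq0.
Qed.

Lemma is_derive_mode1 w p (t : R) :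
  is_derive t 1 (mode1 w p) (dcoef w p * mode1 w (flip p) t).
Proof.
have H : is_derive t 1 (fun s : R => p.1%:R * w * s) (p.1%:R * w).
  have := @is_deriveZ _ _ _ (@id R) (p.1%:R * w) t 1 1 (is_derive_id _ _).
  by rewrite [_ *: _]mulr1.
rewrite /mode1 /dcoef /flip/=; case: p.2 => /=.
  apply: (is_derive_eq (is_derive1_comp (is_derive_cos _) H)).
  by ring.
apply: (is_derive_eq (is_derive1_comp (is_derive_sin _) H)).
by ring.
Qed.

Lemma continuous_mode1 w p : continuous (mode1 w p).
Proof.
move=> t; apply/differentiable_continuous/derivable1_diffP.
by have [] := is_derive_mode1 w p t.
Qed.

Lemma mode1_periodic l p (t : R) : l != 0 ->
  mode1 (2 * pi / l) p (t + l) = mode1 (2 * pi / l) p t.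
Proof.
move=> l0; rewrite /mode1.
have -> : p.1%:R * (2 * pi / l) * (t + l) =
    p.1%:R * (2 * pi / l) * t + (pi *+ 2) *+ p.1.
  by rewrite -[pi *+ 2]mulr_natl -[RHS]addrC -[X in _ = X + _]mulr_natl; field.
by case: p.2; rewrite periodicn//; [exact: cosD2pi|exact: sinD2pi].
Qed.

Lemma integral_periodic_derive a l (F f : R -> R) : 0 < l ->
  (forall t : R, is_derive t 1 F (f t)) -> continuous f -> F (a + l) = F a ->
  \int[itv_measure a l]_t f t = 0.
Proof.
move=> l0 dF cf Fal.
have cF : continuous F.
  move=> t; apply/differentiable_continuous/derivable1_diffP.
  by have [] := dF t.
rewrite /Rintegral integral_mrestr; last first.
  by apply/measurable_EFinP; exact: continuous_measurable_fun.
rewrite (continuous_FTC2 (F := F)) ?Fal ?subee ?ltrDl//.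
- exact: continuous_subspaceT.
- split.
  + by move=> t _; have [] := dF t.
  + exact/cvg_at_right_filter/cF.
  + exact/cvg_at_left_filter/cF.
- by move=> t _; rewrite derive1E; have [] := dF t.
Qed.

(** The product of two modes is a nonzero multiple of the derivative of a periodic
    function.  For different wave numbers this function is the Wronskian, whose
    derivative carries the difference of the eigenvalues; for the cosine and the sine
    of the same wave number it is the square of one of them. *)
Lemma mode1_orthogonal a l p q : 0 < l -> p != q ->
  \int[itv_measure a l]_t (mode1 (2 * pi / l) p t * mode1 (2 * pi / l) q t) = 0.
Proof.
move=> l0 pq; have l_neq0 : l != 0 by rewrite gt_eqF.
set w := 2 * pi / l.
have w0 : w != 0 by rewrite gt_eqF// /w divr_gt0// mulr_gt0// pi_gt0.
have per r t : mode1 w r (t + l) = mode1 w r t by exact: mode1_periodic.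
clearbody w.
have cpq : continuous (fun t : R => mode1 w p t * mode1 w q t).
  by move=> t; apply: cvgM; exact: continuous_mode1.
(* it suffices to exhibit a nonzero multiple of the integrand as a derivative *)
have suff_c (c : R) (F : R -> R) : c != 0 ->
    (forall t : R, is_derive t 1 F (c * (mode1 w p t * mode1 w q t))) ->
    (forall t, F (t + l) = F t) ->
    \int[itv_measure a l]_t (mode1 w p t * mode1 w q t) = 0.
  move=> c0 dF FP; apply/eqP; rewrite -(mulrI_eq0 _ (mulfI c0)); apply/eqP.
  rewrite -RintegralZl//.
    apply: (integral_periodic_derive l0 dF _ (FP a)) => t.
    by apply: cvgM; [exact: cvg_cst|exact: cpq].
  apply: (bounded_integrable (finite_setT_lty _) (M := 1)).
    exact: continuous_measurable_fun.
  by move=> t; rewrite normrM mulr_ile1 ?mode1_le1.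
have [p1q1|p1q1] := eqVneq p.1 q.1.
  have qE := flip_of_neq p1q1 pq.
  have [n0|n0] := eqVneq p.1 0%N.
    rewrite (_ : (fun t => _) = cst 0) ?Rintegral_cst ?mul0r//.
    apply/funext => t; rewrite qE /mode1/= n0 !mul0r sin0.
    by case: p.2; rewrite /= ?mulr0 ?mul0r.
  have dF (t : R) := @is_deriveM _ _ _ _ t 1 _ _ (is_derive_mode1 w p t) (is_derive_mode1 w p t).
  apply: (suff_c (2 * dcoef w p) (mode1 w p * mode1 w p)).
  - by apply: mulf_neq0; [rewrite pnatr_eq0|exact: dcoef_neq0].
  - move=> t; apply: (is_derive_eq (dF t)).
    by rewrite qE /GRing.scale/=; ring.
  - by move=> t; rewrite !fctE per.
have dw r (t : R) := is_derive_mode1 w r t.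
have dZ r (t : R) := @is_deriveZ _ _ _ _ (dcoef w r) t 1 _ (dw (flip r) t).
pose F : R -> R := (dcoef w p \*: mode1 w (flip p)) * mode1 w q -
  mode1 w p * (dcoef w q \*: mode1 w (flip q)).
have dF (t : R) := is_deriveB (is_deriveM (dZ p t) (dw q t)) (is_deriveM (dw p t) (dZ q t)).
apply: (suff_c ((q.1%:R * w) ^+ 2 - (p.1%:R * w) ^+ 2) F).
- rewrite !exprMn -mulrBl; apply: mulf_neq0; last by rewrite sqrf_eq0.
  rewrite subr_sqr; apply: mulf_neq0; first by rewrite subr_eq0 eqr_nat eq_sym.
  rewrite -natrD pnatr_eq0 addn_eq0; apply: contra p1q1 => /andP[/eqP -> /eqP ->].
  by [].
- move=> t; apply: (is_derive_eq (dF t)).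
  have flipK r : flip (flip r) = r by case: r => n b; rewrite /flip/= negbK.
  rewrite !flipK.
  have := dcoef_flip w p; have := dcoef_flip w q.
  move: (dcoef w p) (dcoef w q) (dcoef w (flip p)) (dcoef w (flip q)) => A B C D h1 h2.
  set m1 := mode1 w p t; set m2 := mode1 w q t.
  set n1 := mode1 w (flip p) t; set n2 := mode1 w (flip q) t.
  transitivity (A * n1 * (B * n2) + m2 * (A * (C * m1)) -
    (m1 * (B * (D * m2)) + B * n2 * (A * n1))); first by [].
  transitivity ((A * C - B * D) * (m1 * m2)); first ring.
  by rewrite h1 h2; ring.
- have FE t : F t = dcoef w p * mode1 w (flip p) t * mode1 w q t -
    mode1 w p t * (dcoef w q * mode1 w (flip q) t) by [].
  by move=> t; rewrite !FE !per.
Qed.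
End modes_1d.

(** * Periodic functions on the box *)

Section functions_on_row_vectors.
Variables (R : realType) (d : nat).
Implicit Types (F : 'rV[R]_d -> R) (a L : 'I_d -> R).

Lemma mode_upd w (k : 'I_d -> nat * bool) (x : Rpoint R d) i t :
  mode w k (tnth (upd x i t)) =
  mode1 (w i) (k i) t * \prod_(j | j != i) mode1 (w j) (k j) (tnth x j).
Proof.
rewrite /mode (bigD1 i)//= tnth_upd eqxx; congr (_ * _).
by apply: eq_bigr => j ji; rewrite tnth_upd (negbTE ji).
Qed.

(** Two different indices differ in some coordinate, and integrating along that
    coordinate gives zero. *)
Lemma mode_orthogonal a L (k l : {ffun 'I_d -> nat * bool}) :
  (forall i, 0 < L i) -> k != l ->
  \int[mu_box a L]_x (mode (freq L) k (tnth x) * mode (freq L) l (tnth x)) = 0.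
Proof.
move=> hL kl; have [i kli] : exists i, k i != l i.
  apply: contrapT => /forallNP kl'; move/eqP : kl; apply; apply/ffunP => i.
  by apply/eqP; apply: contrapT => /negP; exact: kl'.
apply: (@integral_box_slice0 _ _ _ _ _ i 1).
- by apply: measurable_funM; exact: measurable_mode.
- by move=> x; rewrite normrM mulr_ile1// mode_le1.
move=> x; under eq_Rintegral do rewrite !mode_upd mulrACA.
rewrite RintegralZr//; first by rewrite mode1_orthogonal// mul0r.
apply: (bounded_integrable (finite_setT_lty _) (M := 1)).
  by apply: measurable_funM; exact: measurable_mode1.
by move=> t; rewrite normrM mulr_ile1 ?mode1_le1.
Qed.

Lemma to_rowE (x : Rpoint R d) i : to_row x 0 i = tnth x i.
Proof. by rewrite mxE. Qed.

Lemma to_row_upd (x : Rpoint R d) i t :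
  to_row (upd x i t) = to_row (upd x i 0) + t *: unit_vec R i.
Proof.
apply/rowP => j; rewrite !mxE !tnth_upd eqxx /=.
by case: eqP => _; rewrite ?mulr1 ?mulr0 ?add0r ?addr0.
Qed.

(** Open sets of row vectors are defined by the norm, measurable sets of tuples by
    the coordinates; an open set is a countable union of cubes with rational centres
    and radii [1 / (m + 1)], and cubes are products of intervals. *)
Lemma measurable_to_row_open (U : set 'rV[R]_d) : open U ->
  measurable (@to_row R d @^-1` U).
Proof.
move=> oU.
pose B (c : 'rV[rat]_d * nat) : set 'rV[R]_d :=
  [set y | forall i, `|ratr (c.1 0 i) - y 0 i| < c.2.+1%:R^-1].
pose A m : set (Rpoint R d) := if unpickle m is Some c then
  (if `[< B c `<=` U >] then @to_row R d @^-1` B c else set0) else set0.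
have mB c : measurable (@to_row R d @^-1` B c).
  rewrite (_ : _ @^-1` _ = \bigcap_(i in [set: 'I_d])
      ((fun x : Rpoint R d => tnth x i) @^-1` ball (ratr (c.1 0 i) : R) c.2.+1%:R^-1)).
    apply: fin_bigcap_measurable => // i _.
    rewrite -[X in measurable X]setTI; apply: measurable_tnth => //.
    exact: measurable_ball.
  apply/seteqP; split=> x /=; first by move=> Bx i _; have := Bx i; rewrite to_rowE.
  by move=> Bx i; rewrite to_rowE; exact: Bx.
have -> : @to_row R d @^-1` U = \bigcup_m A m.
  apply/seteqP; split=> [x /= Ux|x [m _]]; last first.
    rewrite /A; case: (unpickle m) => [c|//].
    by case: ifPn => // /asboolP BU Bx; exact: BU.
  have : nbhs (to_row x) U by exact: open_nbhs_nbhs.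
  move=> /nbhs_ballP[e /= e0 eU].
  have e20 : 0 < e / 2 by rewrite divr_gt0.
  have [m Hm] := harmonic_le e20.
  have {}Hm := Hm m (leqnn m).
  have m0 : 0 < m.+1%:R^-1 :> R by rewrite invr_gt0.
  have qx i : exists q : rat, `|ratr q - tnth x i| < m.+1%:R^-1.
    have /rat_in_itvoo[q] : tnth x i - m.+1%:R^-1 < tnth x i + m.+1%:R^-1.
      by rewrite ltrD2l gtrN.
    by rewrite in_itv/= => /andP[q1 q2]; exists q; rewrite ltr_norml; apply/andP; split;
      [rewrite ltrBrDl|rewrite ltrBlDl].
  have [q Hq] := choice qx.
  exists (pickle (\row_i q i, m)) => //; rewrite /A pickleK ifT.
    by move=> i; rewrite to_rowE mxE; exact: Hq.
  apply/asboolP => y By; apply: eU; split => // i j; rewrite (ord1 i) to_rowE.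
  rewrite /ball/= /ball_; have := By j; rewrite mxE => Byj.
  rewrite (le_lt_trans (ler_distD (ratr (q j)) _ _))//.
  rewrite distrC; move: (Hq j) Byj Hm => /=.
  by move: (m.+1%:R^-1) `|ratr (q j) - tnth x j| `|_ - y 0 j| => p u v; lra.
apply: bigcupT_measurable => m; rewrite /A; case: (unpickle m) => [c|//].
by case: ifP.
Qed.

Lemma continuous_measurable_to_row F : continuous F ->
  measurable_fun setT (F \o @to_row R d).
Proof.
move=> /continuousP cF; apply: (measurability _ (RGenOpens.measurableE R)).
move=> _ [_ [p [q ->] <-]]; rewrite setTI comp_preimage.
by apply: measurable_to_row_open; apply: cF; exact: interval_open.
Qed.

Definition row_periodic L F := forall i y, F (y + L i *: unit_vec R i) = F y.

Lemma row_periodic_derive L F i : row_periodic L F ->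
  row_periodic L ('D_(unit_vec R i) F).
Proof.
move=> FL j y; rewrite /derive.
rewrite (_ : (fun h : R => _) =
  (fun h => h^-1 *: ((F \o shift y) (h *: unit_vec R i) - F y)))//.
by apply/funext => h /=; rewrite FL addrA FL.
Qed.

Lemma row_periodic_int L F i y (m : int) : row_periodic L F ->
  F (y + (m%:~R * L i) *: unit_vec R i) = F y.
Proof.
move=> FL; have main n z : F (z + (n%:R * L i) *: unit_vec R i) = F z.
  elim: n z => [|n IH] z; first by rewrite mul0r scale0r addr0.
  by rewrite -natr1 mulrDl mul1r scalerDl addrA FL IH.
case: m => n; first exact: main.
by rewrite NegzE mulrNz mulNr scaleNr -[LHS](main n.+1) subrK.
Qed.

(** Translating one coordinate at a time into its interval.  The sequence [s] lists
    the coordinates already treated, for the induction. *)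
Lemma row_periodic_box a L F y (s : seq 'I_d) : (forall i, 0 < L i) ->
  row_periodic L F ->
  exists2 z : 'rV[R]_d, (forall i, i \in s -> a i <= z 0 i <= a i + L i) & F z = F y.
Proof.
move=> hL FL; elim: s => [|i s [z zs zy]]; first by exists y.
(* the number of periods between [z 0 i] and the interval *)
pose m := Num.floor ((z 0 i - a i) / L i).
exists (z + ((- m)%:~R * L i) *: unit_vec R i); last by rewrite row_periodic_int.
have zi : a i <= z 0 i - m%:~R * L i <= a i + L i.
  have := floor_itv ((z 0 i - a i) / L i); rewrite -/m rmorphD/= => /andP[].
  rewrite ler_pdivlMr// ltr_pdivrMr// mulrDl mul1r => m1 m2.
  by apply/andP; split; lra.
move=> j; rewrite !mxE eqxx /= inE rmorphN/=.
case: eqVneq => [->|ji] /= js; first by rewrite mulr1 mulNr.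
by rewrite mulr0 addr0; exact: zs.
Qed.

(** All values are taken on one compact period. *)
Lemma row_periodic_bounded L F : (forall i, 0 < L i) -> row_periodic L F ->
  continuous F -> exists M : R, forall y, `|F y| <= M.
Proof.
move=> hL FL cF.
pose K := [set v : 'rV[R]_d | forall i, `[0, 0 + L i]%classic (v ord0 i)].
have cK : compact K.
  apply: (@rV_compact R d (fun i => `[0, 0 + L i]%classic)) => i.
  exact: segment_compact.
have /compact_bounded[M [_ HM]] : compact (F @` K).
  by apply: continuous_compact => //; exact: continuous_subspaceT.
exists (M + 1) => y.
have [z zK <-] := row_periodic_box (fun=> 0) y (enum 'I_d) hL FL.
apply: HM; first by rewrite ltrDl.
by exists z => // i; rewrite /= in_itv/=; apply: zK; rewrite mem_enum.
Qed.

Lemma derivable_along F (y e : 'rV[R]_d) t : derivable F (y + t *: e) e ->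
  is_derive t 1 (fun s : R => F (y + s *: e)) ('D_e F (y + t *: e)).
Proof.
move=> dF.
have E : (fun h : R => h^-1 *: (((fun s : R => F (y + s *: e)) \o shift t) (h *: 1) -
    F (y + t *: e))) =
  (fun h => h^-1 *: ((F \o shift (y + t *: e)) (h *: e) - F (y + t *: e))).
  apply/funext => h /=; congr (_ *: (F _ - _)).
  by rewrite [h *: 1]mulr1 scalerDl addrCA.
by split; [rewrite /derivable E|rewrite /derive E].
Qed.

(** Along the [i]-th coordinate the integrand is the derivative of a periodic
    function of one variable. *)
Lemma integral_partial0 a L F i : (forall i, 0 < L i) -> row_periodic L F ->
  (forall y, derivable F y (unit_vec R i)) ->
  continuous ('D_(unit_vec R i) F) ->
  \int[mu_box a L]_x 'D_(unit_vec R i) F (to_row x) = 0.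
Proof.
move=> hL FL dF cdF.
have dFL := row_periodic_derive i FL.
have [M HM] := row_periodic_bounded hL dFL cdF.
apply: (@integral_box_slice0 _ _ _ _ _ i M) => //.
  exact: (continuous_measurable_to_row cdF).
move=> x; apply: (integral_periodic_derive
    (F := fun t => F (to_row (upd x i 0) + t *: unit_vec R i))) => //.
- by move=> t; rewrite (to_row_upd x i t); exact: (derivable_along (dF _)).
- rewrite (_ : (fun t => _) =
      (fun t : R => 'D_(unit_vec R i) F (to_row (upd x i 0) + t *: unit_vec R i))); last first.
    by apply/funext => t; rewrite (to_row_upd x i t).
  move=> t; apply: (@continuous_comp _ _ _
    (fun t : R => to_row (upd x i 0) + t *: unit_vec R i) ('D_(unit_vec R i) F));
    last exact: cdF.
  apply: cvgD; first exact: cvg_cst.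
  by apply: cvgZr_tmp; exact: cvg_id.
- by rewrite scalerDl addrA FL.
Qed.
End functions_on_row_vectors.

(** * Modes as test functions *)

Lemma continuous_mul_add_mul (R : realType) (T : topologicalType) (c : R)
    (f g h l : T -> R) :
  continuous f -> continuous g -> continuous h -> continuous l ->
  continuous (fun y => f y * g y + c * (h y * l y)).
Proof.
move=> cf cg ch cl y; apply: cvgD; first by apply: cvgM; [exact: cf|exact: cg].
by apply: cvgM; [exact: cvg_cst|apply: cvgM; [exact: ch|exact: cl]].
Qed.

Section modes_as_test_functions.
Variables (R : realType) (d : nat).
Variables (a L : 'I_d -> R).
Hypothesis hL : forall i, 0 < L i.
Implicit Types (k : {ffun 'I_d -> nat * bool}) (psi : 'rV[R]_d -> R).

Let w := freq L.

(** The modes seen on row vectors, where they can be differentiated and serve as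
    test functions. *)
Definition mode_row k (y : 'rV[R]_d) : R := mode (freq L) k (y 0).

Definition flip_at k i : {ffun 'I_d -> nat * bool} :=
  [ffun j => if j == i then flip (k j) else k j].

Lemma mode_row_to_row k x : mode_row k (to_row x) = mode (freq L) k (tnth x).
Proof. by apply: eq_bigr => i _; rewrite to_rowE. Qed.

Let C k i (y : 'rV[R]_d) := \prod_(j | j != i) mode1 (w j) (k j) (y 0 j).

Lemma mode_rowD k i (y : 'rV[R]_d) h :
  mode_row k (h *: unit_vec R i + y) = mode1 (w i) (k i) (h + y 0 i) * C k i y.
Proof.
rewrite /mode_row /mode (bigD1 i)//= !mxE !eqxx/= mulr1; congr (_ * _).
by apply: eq_bigr => j ji; rewrite !mxE (negbTE ji) mulr0 add0r.
Qed.

Lemma mode_rowE k i (y : 'rV[R]_d) :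
  mode_row k y = mode1 (w i) (k i) (y 0 i) * C k i y.
Proof. by rewrite /mode_row /mode (bigD1 i). Qed.

Lemma is_derive_mode_row k i (y : 'rV[R]_d) :
  is_derive y (unit_vec R i) (mode_row k)
    (dcoef (w i) (k i) * mode_row (flip_at k i) y).
Proof.
have CE : C (flip_at k i) i y = C k i y.
  by apply: eq_bigr => j ji; rewrite ffunE (negbTE ji).
have D := @is_deriveZ _ _ _ _ (C k i y) (y 0 i) 1 _ (is_derive_mode1 (w i) (k i) (y 0 i)).
have E : (fun h : R => h^-1 *: ((mode_row k \o shift y) (h *: unit_vec R i) - mode_row k y)) =
  (fun h => h^-1 *: (((C k i y \*: mode1 (w i) (k i)) \o shift (y 0 i)) (h *: 1) -
     (C k i y \*: mode1 (w i) (k i)) (y 0 i))).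
  apply/funext => h /=; rewrite mode_rowD (mode_rowE k i).
  by rewrite [h *: 1]mulr1 ![mode1 _ _ _ * _]mulrC.
case: D => D1 D2; split.
  by rewrite /derivable E.
rewrite /derive E [LHS]D2 (mode_rowE (flip_at k i) i) CE ffunE eqxx.
by rewrite [LHS]mulrC; ring.
Qed.

Lemma continuous_mode_row k : continuous (mode_row k).
Proof.
apply: (continuous_big mul_continuous) => i _ y.
apply: (@continuous_comp _ _ _ (fun y : 'rV[R]_d => y 0 i) (mode1 (freq L i) (k i))).
  exact: coord_continuous.
exact: continuous_mode1.
Qed.

Lemma row_periodic_mode_row k : row_periodic L (mode_row k).
Proof.
move=> i y; rewrite addrC mode_rowD (mode_rowE k i) addrC /w /freq.
by rewrite mode1_periodic// gt_eqF.
Qed.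

(** Every iterated derivative of a mode is a multiple of a mode; all smoothness of
    modes comes from this. *)
Lemma partials_mode_row k s : exists c k',
  partials s (mode_row k) = (fun y => c * mode_row k' y).
Proof.
elim: s => [|i s [c [k' IH]]].
  by exists 1, k; apply/funext => y; rewrite mul1r.
exists (c * dcoef (w i) (k' i)), (flip_at k' i).
rewrite /= IH; apply/funext => y.
have D := @is_deriveZ _ _ _ _ c y (unit_vec R i) _ (is_derive_mode_row k' i y).
by rewrite [LHS](derive_val (is_derive := D)) -mulrA.
Qed.

Lemma test_fun_mode_row k : test_fun L (mode_row k).
Proof.
split; first exact: row_periodic_mode_row.
- move=> s; have [c [k' ->]] := partials_mode_row k s => y.
  apply: (@continuousM _ _ (cst c) (mode_row k')); first exact: cst_continuous.
  exact: continuous_mode_row.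
- move=> s i y; have [c [k' ->]] := partials_mode_row k s.
  by have [] := @is_deriveZ _ _ _ _ c y (unit_vec R i) _ (is_derive_mode_row k' i y).
Qed.

Lemma derive_mode_row k i :
  'D_(unit_vec R i) (mode_row k) =
  (fun y => dcoef (w i) (k i) * mode_row (flip_at k i) y).
Proof. by apply/funext => y; have [_ ->] := is_derive_mode_row k i y. Qed.

Lemma test_fun_L2 psi : row_periodic L psi -> continuous psi ->
  L2 (mu_box a L) (psi \o @to_row R d).
Proof.
move=> pL cpsi; have [M HM] := row_periodic_bounded hL pL cpsi.
apply: (L2_bounded (M := M)); first exact: mu_box_lty.
  exact: continuous_measurable_to_row.
by move=> x; exact: HM.
Qed.

(** The derivative of the periodic function [mode_row k * psi] integrates to zero.
    For a general [psi] this says what the weak derivative of a mode is; for [psi] a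
    mode it compares the norms of a mode and of its derivative. *)
Lemma integral_by_parts_mode k i psi : test_fun L psi ->
  ip (mu_box a L) (mode_row k \o @to_row R d) ('D_(unit_vec R i) psi \o @to_row R d) =
  - (dcoef (w i) (k i) *
     ip (mu_box a L) (mode_row (flip_at k i) \o @to_row R d) (psi \o @to_row R d)).
Proof.
case=> pL cpsi dpsi.
have cp : continuous psi := cpsi [::].
have cdp : continuous ('D_(unit_vec R i) psi) := cpsi [:: i].
have dp y : derivable psi y (unit_vec R i) := dpsi [::] i y.
have dpL := row_periodic_derive i pL.
pose F (y : 'rV[R]_d) : R := mode_row k y * psi y.
have DM (y : 'rV[R]_d) : is_derive y (unit_vec R i) F
    (mode_row k y * 'D_(unit_vec R i) psi y +
     psi y * (dcoef (w i) (k i) * mode_row (flip_at k i) y)).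
  exact: (is_deriveM (is_derive_mode_row k i y) (derivableP (dp y))).
have DE : 'D_(unit_vec R i) F =
    (fun y => mode_row k y * 'D_(unit_vec R i) psi y +
      dcoef (w i) (k i) * (mode_row (flip_at k i) y * psi y)).
  apply/funext => y; by have [_ ->] := DM y; ring.
have m2 k' := test_fun_L2 (@row_periodic_mode_row k') (@continuous_mode_row k').
have p2 := test_fun_L2 pL cp.
have dp2 := test_fun_L2 dpL cdp.
have i1 := L2_integrable_mul (m2 k) dp2.
have i2 := L2_integrable_mul (m2 (flip_at k i)) p2.
apply/eqP; rewrite -addr_eq0; apply/eqP.
rewrite -RintegralZl// -RintegralD//; last first.
  by under [X in _.-integrable _ X]eq_fun do rewrite /= EFinM; exact: integrableZl.
transitivity (\int[mu_box a L]_x 'D_(unit_vec R i) F (to_row x)).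
  apply: eq_Rintegral => x _.
  by have /(congr1 (fun f => f (to_row x))) /= := DE => ->.
apply: (@integral_partial0 R d a L F i hL).
- by move=> j y; rewrite /F row_periodic_mode_row pL.
- by move=> y; have [] := DM y.
- rewrite DE; apply: continuous_mul_add_mul; do ?exact: continuous_mode_row.
  + exact: cdp.
  + exact: cp.
Qed.
End modes_as_test_functions.

(** * Weak gradients and the inverse Laplacian *)

Section inverse_laplacian.
Variables (R : realType) (d : nat).
Variables (a L : 'I_d -> R).
Hypothesis hL : forall i, 0 < L i.
Implicit Types (k : {ffun 'I_d -> nat * bool}) (psi : 'rV[R]_d -> R).

Let w := freq L.
Let mu := mu_box a L.
Let muT : (mu setT < +oo)%E := mu_box_lty a L.

Definition decode (m : nat) : option {ffun 'I_d -> nat * bool} := pickle_inv m.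

(** The modes enumerated by natural numbers; a number that codes no index gives the
    zero function. *)
Definition fmode (m : nat) (x : Rpoint R d) : R :=
  if decode m is Some k then mode_row L k (to_row x) else 0.

(** The classical [i]-th partial derivative of [fmode m]. *)
Definition dfmode i (m : nat) (x : Rpoint R d) : R :=
  if decode m is Some k then
    dcoef (w i) (k i) * mode_row L (flip_at k i) (to_row x) else 0.

(** The eigenvalue of minus the second derivative in direction [i] on [fmode m]. *)
Definition kappa i (m : nat) : R :=
  if decode m is Some k then ((k i).1%:R * w i) ^+ 2 else 0.

(** The eigenvalue of minus the Laplacian on [fmode m]. *)
Definition lambda m := \sum_i kappa i m.

Lemma w_gt0 i : 0 < w i.
Proof. by rewrite /w /freq divr_gt0// mulr_gt0// pi_gt0. Qed.

Lemma mode_row_L2 k : L2 mu (mode_row L k \o @to_row R d).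
Proof.
by apply: test_fun_L2 => //; [exact: row_periodic_mode_row|exact: continuous_mode_row].
Qed.

Lemma fmode_L2 m : L2 mu (fmode m).
Proof.
by rewrite /fmode; case: (decode m) => [k|]; [exact: mode_row_L2|exact: L2_0].
Qed.

Lemma dfmode_L2 i m : L2 mu (dfmode i m).
Proof.
rewrite /dfmode; case: (decode m) => [k|]; last exact: L2_0.
by apply: L2Z; exact: mode_row_L2.
Qed.

Lemma pickle_inv_neq m n k l : decode m = Some k -> decode n = Some l ->
  m != n -> k != l.
Proof.
move=> mk nl; apply: contra => /eqP kl.
have := @pickle_invK {ffun 'I_d -> nat * bool} m; rewrite -/(decode m) mk /= => <-.
by have := @pickle_invK {ffun 'I_d -> nat * bool} n; rewrite -/(decode n) nl /= => <-; rewrite kl.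
Qed.

Lemma mode_row_orthogonal k l : k != l ->
  ip mu (mode_row L k \o @to_row R d) (mode_row L l \o @to_row R d) = 0.
Proof.
move=> kl; rewrite /ip -[RHS](mode_orthogonal a hL kl).
by apply: eq_Rintegral => x _; rewrite /= !mode_row_to_row.
Qed.

Lemma fmode_orthogonal m n : m != n -> ip mu (fmode m) (fmode n) = 0.
Proof.
move=> mn; rewrite /fmode; case mk: (decode m) => [k|]; last exact: ip0l.
case nl: (decode n) => [l|]; last by rewrite ipC; exact: ip0l.
exact: mode_row_orthogonal (pickle_inv_neq mk nl mn).
Qed.

Lemma flip_at_neq k l i : k != l -> flip_at k i != flip_at l i.
Proof.
apply: contra => /eqP/ffunP kl; apply/eqP/ffunP => j.
have := kl j; rewrite !ffunE; case: eqP => // _.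
rewrite /flip; case: (k j) (l j) => [n b] [n' b'] /= [-> /negb_inj ->].
by [].
Qed.

Lemma flip_atK k i : flip_at (flip_at k i) i = k.
Proof.
apply/ffunP => j; rewrite !ffunE; case: eqP => // _.
by rewrite /flip/= negbK; case: (k j).
Qed.

Lemma dfmode_orthogonal i m n : m != n -> ip mu (dfmode i m) (dfmode i n) = 0.
Proof.
move=> mn; rewrite /dfmode; case mk: (decode m) => [k|]; last exact: ip0l.
case nl: (decode n) => [l|]; last by rewrite ipC; exact: ip0l.
rewrite ipZl; [|exact: mode_row_L2|by apply: L2Z; exact: mode_row_L2].
rewrite ipC ipZl; [|exact: mode_row_L2|exact: mode_row_L2].
rewrite mode_row_orthogonal ?mulr0//.
by apply: flip_at_neq; rewrite eq_sym; exact: pickle_inv_neq mk nl mn.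
Qed.

Lemma fmode_total h : L2 mu h -> (forall m, ip mu h (fmode m) = 0) ->
  {ae mu, forall x, h x = 0}.
Proof.
move=> h2 h0; apply: (total_modes hL).
  have := L2_integrable_mul h2 (L2_bounded muT (measurable_cst (1 : R)) (M := 1) _).
  under [X in (_ -> _.-integrable _ X) -> _]eq_fun do rewrite /= mulr1.
  by apply => x; rewrite /= normr1.
move=> k; rewrite -(h0 (pickle k)) /fmode /decode pickleK_inv.
by apply: eq_Rintegral => x _; rewrite mode_row_to_row.
Qed.

Lemma fmode_by_parts i m psi : test_fun L psi ->
  ip mu (fmode m) ('D_(unit_vec R i) psi \o @to_row R d) =
  - ip mu (dfmode i m) (psi \o @to_row R d).
Proof.
move=> tpsi; rewrite /fmode /dfmode; case: (decode m) => [k|].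
  rewrite (integral_by_parts_mode a hL k i tpsi) ipZl//; first exact: mode_row_L2.
  by case: tpsi => pL cpsi _; apply: test_fun_L2 => //; exact: (cpsi [::]).
by rewrite !ip0l oppr0.
Qed.

Lemma ip_derive_mode_row k i g : L2 mu g ->
  ip mu g ('D_(unit_vec R i) (mode_row L k) \o @to_row R d) =
  dcoef (w i) (k i) * ip mu g (mode_row L (flip_at k i) \o @to_row R d).
Proof.
move=> g2; rewrite derive_mode_row [in LHS]ipC ipZl//; last exact: mode_row_L2.
by rewrite ipC.
Qed.

(** The derivative of a mode is a multiple of a mode, so it is a test function; moving
    the weak derivative onto it differentiates the mode twice in direction [i]. *)
Lemma ip_weak_partial_dfmode i m Y g : L2 mu Y -> is_weak_partial a L i Y g ->
  ip mu g (dfmode i m) = kappa i m * ip mu Y (fmode m).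
Proof.
move=> Y2 [[_ g2] gY]; rewrite /dfmode /kappa /fmode.
case: (decode m) => [k|]; last by rewrite ipC ip0l mul0r.
have := gY _ (test_fun_mode_row hL (flip_at k i)).
rewrite -[X in X = _]/(ip mu Y ('D_(unit_vec R i) (mode_row L (flip_at k i)) \o @to_row R d)).
rewrite -[X in - X]/(ip mu g (mode_row L (flip_at k i) \o @to_row R d)).
rewrite ip_derive_mode_row// flip_atK ffunE eqxx => H.
rewrite ipC ipZl//; last exact: mode_row_L2.
rewrite ipC -[ip mu g _]opprK -H mulrN mulrA dcoef_flip mulNr opprK//.
Qed.

Lemma ip_dfmode i m : ip mu (dfmode i m) (dfmode i m) =
  kappa i m * ip mu (fmode m) (fmode m).
Proof.
rewrite /dfmode /kappa /fmode; case: (decode m) => [k|]; last by rewrite !ip0l mul0r.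
have := integral_by_parts_mode a hL k i (test_fun_mode_row hL (flip_at k i)).
rewrite ip_derive_mode_row; last exact: mode_row_L2.
rewrite flip_atK ffunE eqxx -/mu -/w => H.
rewrite ipZl; [|exact: mode_row_L2|by apply: L2Z; exact: mode_row_L2].
rewrite ipC ipZl; [|exact: mode_row_L2|exact: mode_row_L2].
rewrite -[dcoef _ _ * ip _ _ _]opprK -H mulrN mulrA dcoef_flip mulNr opprK//.
Qed.

Lemma kappa_ge0 i m : 0 <= kappa i m.
Proof. by rewrite /kappa; case: (decode m) => [k|//]; exact: sqr_ge0. Qed.

Lemma kappa_le_lambda i m : kappa i m <= lambda m.
Proof. by rewrite /lambda (bigD1 i)//= lerDl sumr_ge0// => j _; exact: kappa_ge0. Qed.

Lemma lambda_ge0 m : 0 <= lambda m.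
Proof. by apply: sumr_ge0 => i _; exact: kappa_ge0. Qed.

(** A nonzero eigenvalue involves a nonzero wave number in some direction [i], so it
    is at least the square of the lowest frequency in that direction.  Summing the
    reciprocals over all directions bounds each of them. *)
Lemma lambda_gap : exists2 C : R, 0 <= C & forall m, lambda m != 0 -> (lambda m)^-1 <= C.
Proof.
exists (\sum_i (w i ^+ 2)^-1).
  by apply: sumr_ge0 => i _; rewrite invr_ge0 sqr_ge0.
move=> m l0; have lgt0 : 0 < lambda m by rewrite lt_neqAle eq_sym l0 lambda_ge0.
have [i ki] : exists i, kappa i m != 0.
  apply: contrapT => /forallNP k0; move/eqP : l0; apply.
  by apply: big1 => i _; apply/eqP; apply: contrapT => /negP; exact: k0.
have wk : w i ^+ 2 <= kappa i m.
  move: ki; rewrite /kappa; case: (decode m) => [k|]; last by rewrite eqxx.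
  rewrite sqrf_eq0 mulf_eq0 negb_or pnatr_eq0 -lt0n => /andP[k0 _].
  by rewrite [leRHS]exprMn; apply: ler_peMl; [exact: sqr_ge0|rewrite exprn_ege1// ler1n].
have {}wk : w i ^+ 2 <= lambda m := le_trans wk (kappa_le_lambda i m).
apply: (@le_trans _ _ (w i ^+ 2)^-1).
  by rewrite lef_pV2// posrE exprn_gt0// w_gt0.
by rewrite (bigD1 i)//= lerDl sumr_ge0// => j _; rewrite invr_ge0 sqr_ge0.
Qed.

Lemma to_row_translate i x : to_row (translate L i x) = to_row x + L i *: unit_vec R i.
Proof.
apply/rowP => j; rewrite !mxE tnth_mktuple eqxx/=.
by case: eqP => [->|_]; rewrite ?mulr1 ?mulr0.
Qed.

Lemma fmode_periodic m : box_periodic L (fmode m).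
Proof.
move=> i x; rewrite /fmode; case: (decode m) => // k.
by rewrite to_row_translate (row_periodic_mode_row hL).
Qed.

Lemma dfmode_periodic i m : box_periodic L (dfmode i m).
Proof.
move=> j x; rewrite /dfmode; case: (decode m) => // k.
by rewrite to_row_translate (row_periodic_mode_row hL).
Qed.

(** All wave numbers are zero, and each factor is [cos 0] or [sin 0]. *)
Lemma fmode_lambda0 m x y : lambda m = 0 -> fmode m x = fmode m y.
Proof.
move=> l0; rewrite /fmode; case mk: (decode m) => [k|//].
apply: eq_bigr => i _.
have : kappa i m == 0 by rewrite eq_le kappa_ge0 andbT -l0 kappa_le_lambda.
rewrite /kappa mk sqrf_eq0 mulf_eq0 (gt_eqF (w_gt0 i)) orbF /mode1 => /eqP ->.
by rewrite !mul0r.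
Qed.

Lemma ip_fmode_lambda0 u m : L2 mu u -> \int[mu]_x u x = 0 -> lambda m = 0 ->
  ip mu u (fmode m) = 0.
Proof.
move=> u2 u0 l0; pose x0 : Rpoint R d := [tuple 0 | i < d].
rewrite ipC (_ : fmode m = fun=> fmode m x0 * 1).
  rewrite ipZl//; last by apply: (L2_bounded muT (M := 1)) => // x; rewrite normr1.
  rewrite /ip (_ : (fun x => 1 * u x) = u) ?[X in _ * X]u0 ?mulr0//.
  by apply/funext => x; rewrite mul1r.
by apply/funext => x; rewrite mulr1; exact: fmode_lambda0.
Qed.

Lemma integral_fmode m : lambda m != 0 -> \int[mu]_x fmode m x = 0.
Proof.
move=> l0; (* the constant 1 is itself a mode, distinct from [fmode m] *)
pose k0 : {ffun 'I_d -> nat * bool} := [ffun=> (0, true)].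
have m1 : mode_row L k0 \o @to_row R d = cst 1.
  apply/funext => x; rewrite /= /mode_row /mode big1// => i _.
  by rewrite ffunE /mode1/= !mul0r cos0.
rewrite -[LHS](_ : ip mu (fmode m) (mode_row L k0 \o @to_row R d) = _); last first.
  by apply: eq_Rintegral => x _; rewrite m1 mulr1.
move: l0; rewrite /lambda /kappa /fmode.
case: (decode m) => [k|]; last by rewrite ip0l.
move=> l0; apply: mode_row_orthogonal; apply: contra l0 => /eqP ->.
by apply/eqP; apply: big1 => i _; rewrite ffunE /= mul0r expr0n.
Qed.

Lemma integral_dot F G : (forall i, L2 mu (F i)) -> (forall i, L2 mu (G i)) ->
  \int[mu]_x dot F G x = \sum_i ip mu (F i) (G i).
Proof.
move=> F2 G2; rewrite /dot.
by have [_ ->] := Rintegral_sum (index_enum 'I_d) (fun i => L2_integrable_mul (F2 i) (G2 i)).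
Qed.

Lemma weak_gradP Y i : H1per a L Y -> is_weak_partial a L i Y (weak_grad a L Y i).
Proof. by move=> [_ /(_ i) [g gY]]; apply: xgetPex; exists g. Qed.

(** Modes are test functions, so the difference of two weak derivatives is
    orthogonal to all of them. *)
Lemma weak_partial_unique i Y g g' : is_weak_partial a L i Y g ->
  is_weak_partial a L i Y g' -> {ae mu, forall x, g x = g' x}.
Proof.
move=> [[_ g2] gY] [[_ g'2] g'Y].
have : {ae mu, forall x, g x - g' x = 0}.
  apply: fmode_total; first exact: L2B.
  move=> m; rewrite /fmode; case: (decode m) => [k|]; last by rewrite ipC ip0l.
  rewrite ipBl//; last exact: mode_row_L2.
  have := gY _ (test_fun_mode_row hL k); rewrite g'Y; last exact: test_fun_mode_row.
  by move/oppr_inj; rewrite /ip => ->; rewrite subrr.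
by apply: filterS => x /eqP; rewrite subr_eq0 => /eqP.
Qed.

Lemma weak_grad_ip i Y g h : is_weak_partial a L i Y g -> H1per a L Y -> L2 mu h ->
  ip mu (weak_grad a L Y i) h = ip mu g h.
Proof.
move=> gY YH h2; have wY := weak_gradP i YH; have [[_ wg2] _] := wY.
have [[_ g2] _] := gY.
apply: ae_eq_ip; [exact: L2_measurable wg2|exact: L2_measurable g2|exact: L2_measurable h2|].
exact: weak_partial_unique wY gY.
Qed.

(** The solution is the series with coefficients [- c_m / lambda_m].  Its weak
    gradient is the termwise one, because the weak formulation passes to L2 limits.
    Pairing that gradient with [grad Y] multiplies the [m]-th term by [lambda_m], and
    what results is the Fourier expansion of [- (u, Y)].  Terms with
    [lambda_m = 0] are constants: their coefficient in [v] is [0], as division by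
    zero gives [0], and their coefficient in [u] is [0] as [u] has mean zero. *)
Lemma inv_laplacian_exists u : L2per a L u -> mean_zero a L u ->
  exists v, is_inv_laplacian a L u v.
Proof.
move=> [uper u2] u0; have {}u2 : L2 mu u := u2.
have [C C0 HC] := lambda_gap.
pose c := fcoef mu fmode u.
pose b m := - (c m / lambda m).
have bess n := bessel fmode_L2 fmode_orthogonal n u2.
have lambdaV m : 0 <= (lambda m)^-1 <= C.
  rewrite invr_ge0 lambda_ge0/=; have [->|l0] := eqVneq (lambda m) 0; last exact: HC.
  by rewrite invr0.
have bv n : \sum_(0 <= k < n) b k ^+ 2 * ip mu (fmode k) (fmode k) <= C ^+ 2 * ip mu u u.
  apply: (@le_trans _ _ (C ^+ 2 * \sum_(0 <= k < n) c k ^+ 2 * ip mu (fmode k) (fmode k))).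
    rewrite mulr_sumr ler_sum// => k _; rewrite mulrA ler_wpM2r ?ip_ge0//.
    rewrite /b sqrrN exprMn mulrC ler_wpM2r ?sqr_ge0//.
    by have /andP[l0 lC] := lambdaV k; rewrite lerXn2r ?nnegrE.
  by rewrite ler_wpM2l ?sqr_ge0.
have bG i n : \sum_(0 <= k < n) b k ^+ 2 * ip mu (dfmode i k) (dfmode i k) <= C * ip mu u u.
  apply: (@le_trans _ _ (C * \sum_(0 <= k < n) c k ^+ 2 * ip mu (fmode k) (fmode k))).
    rewrite mulr_sumr ler_sum// => k _; rewrite ip_dfmode.
    have /andP[l0 lC] := lambdaV k; have kl := kappa_le_lambda i k; have k0 := kappa_ge0 i k.
    suff bk : b k ^+ 2 * kappa i k <= C * c k ^+ 2.
      by rewrite [leLHS]mulrA [leRHS]mulrA; apply: ler_wpM2r => //; exact: ip_ge0.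
    have -> : b k ^+ 2 * kappa i k = c k ^+ 2 * ((lambda k)^-1 ^+ 2 * kappa i k).
      by rewrite /b; move: (c k) (lambda k)^-1 (kappa i k) => x y z; ring.
    rewrite [leRHS]mulrC; apply: ler_wpM2l; first exact: sqr_ge0.
    apply: le_trans lC; rewrite expr2 -mulrA ler_piMr//.
    have [l00|l00] := eqVneq (lambda k) 0; first by rewrite l00 invr0 mul0r.
    by rewrite ler_pdivrMl ?mulr1// lt_neqAle eq_sym l00 lambda_ge0.
  by rewrite ler_wpM2l.
have [v [v2 vper vlim]] := orthogonal_series_cvg fmode_L2 fmode_orthogonal muT bv.
have [G HG] := choice (fun i =>
  orthogonal_series_cvg (dfmode_L2 i) (dfmode_orthogonal i) muT (bG i)).
have vpartial i : is_weak_partial a L i v (G i).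
  have [G2 Gper Glim] := HG i; split.
    split=> //; move=> j x; apply: Gper => n; exact: dfmode_periodic.
  move=> psi tpsi; have [pL cpsi dpsi] := tpsi.
  have cp : continuous psi := cpsi [::].
  have cdp : continuous ('D_(unit_vec R i) psi) := cpsi [:: i].
  have dpL := row_periodic_derive i pL.
  have p2 := test_fun_L2 a hL pL cp; have dp2 := test_fun_L2 a hL dpL cdp.
  have l2 : (fun n => - ip mu (psum (dfmode i) b n) (psi \o @to_row R d)) @ \oo -->
      - ip mu (G i) (psi \o @to_row R d) by apply: cvgN; exact: Glim.
  have := vlim _ dp2; rewrite (_ : (fun n => ip mu _ _) =
    (fun n => - ip mu (psum (dfmode i) b n) (psi \o @to_row R d))).
    by move=> l1; exact: (cvg_unique _ l1 l2).
  apply/funext => n; rewrite !ip_psuml//; try exact: fmode_L2; try exact: dfmode_L2.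
  rewrite -sumrN; apply: eq_bigr => k _.
  by rewrite fmode_by_parts// mulrN.
have vH : H1per a L v.
  split; last by move=> i; exists (G i).
  by split=> // i x; apply: vper => n; exact: fmode_periodic.
exists v; split => //.
- have o2 : L2 mu (fun=> 1) by apply: (L2_bounded muT (M := 1)) => // x; rewrite normr1.
  have := vlim _ o2; rewrite (_ : (fun n => _) = cst 0).
    move=> v1; have {}v1 := cvg_unique _ (cvg_cst 0) v1.
    rewrite /mean_zero [RHS](v1 _)//.
    by apply: eq_Rintegral => x _; rewrite mulr1.
  apply/funext => n; rewrite ip_psuml//; last exact: fmode_L2.
  apply: big1 => k _; have [l0|l0] := eqVneq (lambda k) 0.
    by rewrite /b l0 invr0 mulr0 oppr0 mul0r.
  rewrite [X in _ * X](_ : _ = 0) ?mulr0// -[RHS](integral_fmode l0) /ip.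
  by apply: eq_Rintegral => x _; rewrite mulr1.
- move=> Y YH; have [[_ Y2] _] := YH; have {}Y2 : L2 mu Y := Y2.
  have wY i := weak_gradP i YH.
  have wY2 i : L2 mu (weak_grad a L Y i) by have [[]] := wY i.
  have wv2 i : L2 mu (weak_grad a L v i) by have [[]] := weak_gradP i vH.
  rewrite /weak_laplacian /weak_fun -/mu integral_dot//.
  under eq_bigr do rewrite (weak_grad_ip (vpartial _))//.
  have lim1 : (fun n => - \sum_i ip mu (psum (dfmode i) b n) (weak_grad a L Y i)) @ \oo -->
      - \sum_i ip mu (G i) (weak_grad a L Y i).
    apply: cvgN; apply: (cvg_big add_continuous) => i _; have [_ _ Glim] := HG i; exact: Glim.
  have lim2 := fourier_expansion fmode_L2 fmode_orthogonal muT fmode_total u2 Y2.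
  move: lim1; rewrite [X in X @ _ --> _](_ : _ =
    (fun n => ip mu (psum fmode (fcoef mu fmode u) n) Y)).
    by move=> lim1; exact: (cvg_unique _ lim1 lim2).
  apply/funext => n.
  have -> : \sum_i ip mu (psum (dfmode i) b n) (weak_grad a L Y i) =
      \sum_i \sum_(0 <= k < n) kappa i k * (b k * ip mu Y (fmode k)).
    apply: eq_bigr => i _; rewrite ip_psuml//; last exact: dfmode_L2.
    by apply: eq_bigr => k _; rewrite ipC (ip_weak_partial_dfmode _ Y2 (wY i)) mulrCA.
  rewrite ip_psuml//; last exact: fmode_L2.
  rewrite exchange_big/= -sumrN; apply: eq_bigr => k _.
  rewrite -mulr_suml -/(lambda k) [ip mu Y _]ipC mulrA -mulNr; congr (_ * _).
  rewrite /b mulrN opprK -/c.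
  have [l0|l0] := eqVneq (lambda k) 0; last by rewrite mulrC divfK.
  by rewrite l0 mul0r /c /fcoef ip_fmode_lambda0// mul0r.
Qed.

Lemma inv_laplacianP u : L2per a L u -> mean_zero a L u ->
  is_inv_laplacian a L u (inv_laplacian a L u).
Proof.
move=> u2 u0; rewrite /inv_laplacian; apply: xgetPex.
exact: inv_laplacian_exists.
Qed.
End inverse_laplacian.

(** * Negligible integrands and the unit normal field *)

Section integral_of_negligible_function.
Local Open Scope ereal_scope.
Context d (T : measurableType d) (R : realType) (mu : {measure set T -> \bar R}).
Import HBNNSimple.

(** The simple functions below a function that vanishes almost everywhere have
    integral zero, and the integral is the supremum of theirs.  Such an argument
    covers integrands like [H^2 X2^2], where [H] is defined through the derivative of
    a piecewise potential. *)
Lemma integral_ae0 (f : T -> \bar R) : {ae mu, forall x, f x = 0} ->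
  \int[mu]_x f x = 0.
Proof.
have main g : (forall x, 0 <= g x) -> {ae mu, forall x, g x = 0} ->
    \int[mu]_x g x = 0.
  move=> g0 gae; rewrite ge0_integralTE//.
  rewrite [X in ereal_sup X](_ : _ = [set 0]) ?ereal_sup1//.
  apply/seteqP; split => [_ [h/= hg <-]|_ ->]; last first.
    by exists nnsfun0; [move=> x /=; exact: g0|exact: sintegral0].
  rewrite -integralT_nnsfun.
  rewrite (@ae_eq_integral _ _ _ mu setT (cst 0))//; first by rewrite integral0.
    exact/measurable_EFinP.
  apply: filterS gae => x gx _ /=; apply/eqP.
  by rewrite eq_le -{1}gx hg lee_fin/= fun_ge0.
move=> fae; rewrite integralE !main ?sube0//.
  by apply: filterS fae => x fx; rewrite funenegE fx oppe0 maxxx.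
by apply: filterS fae => x fx; rewrite funeposE fx maxxx.
Qed.
End integral_of_negligible_function.

Lemma Rintegral_ae0 d (T : measurableType d) (R : realType)
    (mu : {measure set T -> \bar R}) (f : T -> R) :
  {ae mu, forall x, f x = 0} -> \int[mu]_x f x = 0.
Proof.
move=> f0; rewrite /Rintegral integral_ae0//.
by apply: filterS f0 => x ->.
Qed.

Section unit_normal_field.
Variables (R : realType) (d : nat) (a L : 'I_d -> R).
Hypothesis hL : forall i, 0 < L i.

Let mu := mu_box a L.

Lemma weak_grad_L2 u i : H1per a L u -> L2 mu (weak_grad a L u i).
Proof. by move=> uH; have [[]] := weak_gradP i uH. Qed.

Lemma dot_ge_sqr (g : 'I_d -> Rpoint R d -> R) i x : g i x ^+ 2 <= dot g g x.
Proof.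
rewrite expr2 /dot (bigD1 i)//= lerDl; apply: sumr_ge0 => j _.
exact: sqr_ge0.
Qed.

Lemma Zfield_le1 phi i x : `|Zfield a L phi i x| <= 1.
Proof.
rewrite /Zfield; set g := weak_grad a L phi.
have gs : `|g i x| <= Num.sqrt (dot g g x).
  by rewrite -sqrtr_sqr; apply: ler_wsqrtr; exact: dot_ge_sqr.
rewrite normrM normfV (ger0_norm (sqrtr_ge0 _)).
have [->|s0] := eqVneq (Num.sqrt (dot g g x)) 0; first by rewrite invr0 mulr0.
by rewrite ler_pdivrMr ?mul1r// lt_neqAle eq_sym s0 sqrtr_ge0.
Qed.

(** The quotient by a square root is written as a product with the power [-1/2],
    which agrees with it also at [0]: both conventions give [0] there. *)
Lemma measurable_Zfield phi i : H1per a L phi ->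
  measurable_fun setT (Zfield a L phi i).
Proof.
move=> pH; have mg j := L2_measurable (weak_grad_L2 j pH).
pose s := dot (weak_grad a L phi) (weak_grad a L phi).
have s0 x : 0 <= s x by apply: sumr_ge0 => j _; rewrite -expr2 sqr_ge0.
have ms : measurable_fun setT s.
  by apply: measurable_sum => j; apply: measurable_funM.
rewrite (_ : Zfield a L phi i = fun x => weak_grad a L phi i x * (s x `^ (- 2^-1))).
  apply: measurable_funM => //.
  by apply: (measurableT_comp (measurable_powR _)).
by apply/funext => x; rewrite powRN powR12_sqrt.
Qed.

(** The components of [Z] are bounded by [1]. *)
Lemma dot_Zfield_L2 phi u : H1per a L phi -> H1per a L u ->
  L2 mu (dot (Zfield a L phi) (weak_grad a L u)).
Proof.
move=> pH uH; apply: L2_sum => i; have g2 := weak_grad_L2 i uH.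
apply: (L2_dominated _ g2).
  by apply: measurable_funM; [exact: measurable_Zfield|exact: L2_measurable g2].
by move=> x; rewrite normrM ler_piMl// Zfield_le1.
Qed.
End unit_normal_field.

(** * The bilinear form of the scheme *)

Section bilinear_form.
Variables (R : realType) (d : nat) (a L : 'I_d -> R).
Hypothesis hL : forall i, 0 < L i.

Let mu := mu_box a L.

Definition dirichlet (u v : Rpoint R d -> R) : R :=
  \int[mu]_x dot (weak_grad a L u) (weak_grad a L v) x.

Lemma dirichletC u v : dirichlet u v = dirichlet v u.
Proof.
by apply: eq_Rintegral => x _; apply: eq_bigr => i _; rewrite mulrC.
Qed.

Lemma dirichlet_ge0 u : 0 <= dirichlet u u.
Proof.
apply: Rintegral_ge0 => x _; apply: sumr_ge0 => i _; exact: sqr_ge0.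
Qed.

Lemma dirichlet_eq0 u : H1per a L u -> dirichlet u u = 0 ->
  forall i, {ae mu, forall x, weak_grad a L u i x = 0}.
Proof.
move=> uH; have g2 i := weak_grad_L2 i uH.
rewrite /dirichlet integral_dot// => /eqP.
rewrite psumr_eq0; last by move=> i _; exact: ip_ge0.
move=> /allP g0 i; apply: ip_eq0 => //; apply/eqP.
by have := g0 i; rewrite mem_index_enum; exact.
Qed.

(** [0] is a weak derivative of a function that vanishes almost everywhere, and weak
    derivatives are unique. *)
Lemma weak_grad_ae0 u i : H1per a L u -> {ae mu, forall x, u x = 0} ->
  {ae mu, forall x, weak_grad a L u i x = 0}.
Proof.
move=> uH u0; apply: (weak_partial_unique hL (weak_gradP i uH)).
split; first by split; [|exact: L2_0].
move=> psi _; rewrite !Rintegral_ae0 ?oppr0//.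
  by apply: nearW => x; rewrite mul0r.
by apply: filterS u0 => x ->; rewrite mul0r.
Qed.

Lemma dot_ae0 F (G : 'I_d -> Rpoint R d -> R) :
  (forall i, {ae mu, forall x, G i x = 0}) -> {ae mu, forall x, dot F G x = 0}.
Proof.
move=> G0.
have : {ae mu, forall x, forall i, G i x = 0} by exact: filter_forall.
by apply: filterS => x Gx; apply: big1 => i _; rewrite Gx mulr0.
Qed.

(** Test the equation of [inv_laplacian v] against [inv_laplacian u].  This is the
    symmetry of the inverse Laplacian and the sign of its quadratic form at once. *)
Lemma ip_inv_laplacian u v : L2per a L u -> mean_zero a L u ->
  L2per a L v -> mean_zero a L v ->
  weak_fun a L (inv_laplacian a L u) v =
  - dirichlet (inv_laplacian a L u) (inv_laplacian a L v).
Proof.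
move=> u2 u0 v2 v0; rewrite dirichletC.
have [uH _ _] := inv_laplacianP hL u2 u0.
have [_ _ vP] := inv_laplacianP hL v2 v0.
transitivity (weak_fun a L v (inv_laplacian a L u)); last by rewrite -vP.
apply: eq_Rintegral => x _; exact: mulrC.
Qed.

(** With [v] the inverse Laplacian of [u], the squared norm of [u] is
    [- (grad v, grad u)], and [grad u = 0]. *)
Lemma dirichlet_eq0_mean_zero u : H1per a L u -> mean_zero a L u ->
  dirichlet u u = 0 -> {ae mu, forall x, u x = 0}.
Proof.
move=> uH u0 D0; have [u2 _] := uH; have [_ u2'] := u2.
have [_ _ vP] := inv_laplacianP hL u2 u0.
apply: (ip_eq0 u2'); rewrite (esym (vP _ uH) : ip _ _ _ = _) /weak_laplacian Rintegral_ae0 ?oppr0//.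
by apply: dot_ae0; exact: dirichlet_eq0.
Qed.

Lemma weak_div_mulr (r : Rpoint R d -> R) F Y :
  weak_div a L (fun i x => r x * F i x) Y = - ip mu r (dot F (weak_grad a L Y)).
Proof.
congr (- _); apply: eq_Rintegral => x _; rewrite /dot mulr_sumr.
by apply: eq_bigr => i _; rewrite mulrA.
Qed.

Variables (eps alpha beta M1 M2 eh B dt : R) (phin rhon : Rpoint R d -> R).

Let A := opA a L eps alpha beta M1 M2 eh B dt phin rhon.
Let G := fun u => dot (Zfield a L phin) (weak_grad a L u).
Let Hn x := Hfun eh B (rhon x).
Let v := inv_laplacian a L.

(** The weak terms are expanded, the inverse Laplacians are rewritten as Dirichlet
    forms, and the alpha-terms are collected; their sum is the inner product
    of [X.2 - G X.1] and [Y.2 - G Y.1]. *)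
Lemma pairing_opA X Y : admissible a L X -> admissible a L Y ->
  pairing (A X) Y =
    (M1 * dt)^-1 * dirichlet (v X.1) (v Y.1)
    + (M2 * dt)^-1 * dirichlet (v X.2) (v Y.2)
    + eps * dirichlet X.1 Y.1
    + 2 / eps * \int[mu]_x (phin x ^+ 2 * X.1 x * Y.1 x)
    + beta / 2 * \int[mu]_x (Hn x ^+ 2 * X.2 x * Y.2 x)
    + alpha * (ip mu X.2 Y.2 - ip mu X.2 (G Y.1) - ip mu (G X.1) Y.2
               + ip mu (G X.1) (G Y.1)).
Proof.
move=> [[X1 _] X2 X10 X20] [[Y1 _] Y2 Y10 Y20].
transitivity (
  (- ((M1 * dt)^-1 * weak_fun a L (v X.1) Y.1)
   - eps * weak_laplacian a L X.1 Y.1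
   + (2 / eps * weak_fun a L (fun x => phin x ^+ 2 * X.1 x) Y.1
      + alpha * weak_div a L (fun i x => X.2 x * Zfield a L phin i x) Y.1
      - alpha * weak_div a L (fun i x => G X.1 x * Zfield a L phin i x) Y.1))
  + (- ((M2 * dt)^-1 * weak_fun a L (v X.2) Y.2)
     + (alpha * ip mu X.2 Y.2 - alpha * ip mu (G X.1) Y.2
        + beta / 2 * weak_fun a L (fun x => Hn x ^+ 2 * X.2 x) Y.2))).
  by [].
rewrite !weak_div_mulr.
rewrite (ip_inv_laplacian X1 X10 Y1 Y10).
rewrite (ip_inv_laplacian X2 X20 Y2 Y20).
rewrite /weak_laplacian /weak_fun -/(dirichlet X.1 Y.1).
rewrite -/v -/mu -/(G Y.1).
move: (dirichlet _ _) (dirichlet _ _) (dirichlet _ _) (\int[_]_x (_ * _))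
  (\int[_]_x (_ * _)) (ip _ _ _) (ip _ _ _) (ip _ _ _) (ip _ _ _) => *.
by ring.
Qed.

Lemma pairing_opA_sym X Y : admissible a L X -> admissible a L Y ->
  pairing (A X) Y = pairing (A Y) X.
Proof.
move=> aX aY; rewrite (pairing_opA aX aY) (pairing_opA aY aX).
have E (h f g : Rpoint R d -> R) :
    \int[mu]_x (h x ^+ 2 * f x * g x) = \int[mu]_x (h x ^+ 2 * g x * f x).
  by apply: eq_Rintegral => x _; rewrite mulrAC.
rewrite (E phin Y.1 X.1) (E Hn Y.2 X.2) (dirichletC Y.1 X.1).
rewrite (dirichletC (v Y.1) (v X.1)) (dirichletC (v Y.2) (v X.2)).
rewrite (ipC mu Y.2 X.2) (ipC mu Y.2 (G X.1)) (ipC mu (G Y.1) X.2).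
rewrite (ipC mu (G Y.1) (G X.1)); congr (_ + alpha * (_ + _)).
exact: addrAC.
Qed.

Hypotheses (heps : 0 < eps) (halpha : 0 < alpha) (hbeta : 0 < beta).
Hypotheses (hM1 : 0 < M1) (hM2 : 0 < M2) (hdt : 0 < dt).
Hypothesis hphin : H1per a L phin.

Lemma integral_sqr_mul_ge0 (h f : Rpoint R d -> R) :
  0 <= \int[mu]_x (h x ^+ 2 * f x * f x).
Proof.
by apply: Rintegral_ge0 => x _; rewrite -mulrA mulr_ge0// ?sqr_ge0// -expr2 sqr_ge0.
Qed.

(** The other terms of [pairing_opA] are nonnegative; these two already detect [X]. *)
Lemma pairing_opA_ge X : admissible a L X ->
  eps * dirichlet X.1 X.1
  + alpha * ip mu (fun x => X.2 x - G X.1 x) (fun x => X.2 x - G X.1 x)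
  <= pairing (A X) X.
Proof.
move=> aX; have [X1H [_ X22] _ _] := aX.
have G2 : L2 mu (G X.1) := dot_Zfield_L2 hphin X1H.
rewrite (pairing_opA aX aX) (ip_sub X22 G2).
have key (t1 t2 t3 t4 D I : R) : 0 <= t1 -> 0 <= t2 -> 0 <= t3 -> 0 <= t4 ->
    D + I <= t1 + t2 + D + t3 + t4 + I by lra.
apply: key.
- by apply: mulr_ge0; [rewrite invr_ge0 ltW// mulr_gt0|exact: dirichlet_ge0].
- by apply: mulr_ge0; [rewrite invr_ge0 ltW// mulr_gt0|exact: dirichlet_ge0].
- by apply: mulr_ge0; [rewrite divr_ge0// ltW|exact: integral_sqr_mul_ge0].
- by apply: mulr_ge0; [rewrite divr_ge0// ltW|exact: integral_sqr_mul_ge0].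
Qed.

Lemma pairing_opA_ge0 X : admissible a L X -> 0 <= pairing (A X) X.
Proof.
move=> aX; apply: le_trans (pairing_opA_ge aX).
by rewrite addr_ge0// mulr_ge0 ?dirichlet_ge0 ?ip_ge0// ltW.
Qed.

(** [grad X.1 = 0] and mean zero give [X.1 = 0]; it also makes [G X.1] vanish, so that
    [X.2 - G X.1 = 0] becomes [X.2 = 0]. *)
Lemma pairing_opA_eq0 X : admissible a L X -> pairing (A X) X = 0 ->
  {ae mu, forall x, X.1 x = 0} /\ {ae mu, forall x, X.2 x = 0}.
Proof.
move=> aX A0; have [X1H [_ X22] X10 _] := aX.
have G2 : L2 mu (G X.1) := dot_Zfield_L2 hphin X1H.
have := pairing_opA_ge aX; rewrite A0.
have key (p q D I : R) : 0 < p -> 0 < q -> 0 <= D -> 0 <= I ->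
    p * D + q * I <= 0 -> D = 0 /\ I = 0.
  move=> p0 q0 D0 I0 le0.
  have pD : p * D = 0 by have := mulr_ge0 (ltW p0) D0; have := mulr_ge0 (ltW q0) I0; lra.
  have qI : q * I = 0 by move: le0; rewrite pD; have := mulr_ge0 (ltW q0) I0; lra.
  by split; apply/eqP; [move/eqP: pD|move/eqP: qI]; rewrite mulf_eq0 gt_eqF.
case/(key _ _ _ _ heps halpha (dirichlet_ge0 _) (ip_ge0 _ _)) => DE IE.
split; first exact: dirichlet_eq0_mean_zero.
have := ip_eq0 (L2B X22 G2) IE.
have : {ae mu, forall x, G X.1 x = 0} by apply: dot_ae0; exact: dirichlet_eq0.
by apply: filterS2 => x -> ; rewrite subr0.
Qed.

(** The Dirichlet forms of the inverse Laplacians are read back as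
    [- (inv_laplacian u, u)], which only involves [u]. *)
Lemma pairing_opA_ae0 X : admissible a L X ->
  {ae mu, forall x, X.1 x = 0} -> {ae mu, forall x, X.2 x = 0} ->
  pairing (A X) X = 0.
Proof.
move=> aX X1ae X2ae; have [X1H X2 X10 X20] := aX; have [X1 _] := X1H.
have g0 i := weak_grad_ae0 i X1H X1ae.
have inv0 u : {ae mu, forall x, u x = 0} -> L2per a L u -> mean_zero a L u ->
    dirichlet (v u) (v u) = 0.
  move=> uae u2 u0; apply: oppr_inj; rewrite oppr0 -ip_inv_laplacian//.
  by apply: Rintegral_ae0; apply: filterS uae => x ->; rewrite mulr0.
rewrite pairing_opA// !inv0//.
have -> : dirichlet X.1 X.1 = 0 by apply: Rintegral_ae0; exact: dot_ae0.
have G0 : {ae mu, forall x, G X.1 x = 0} by exact: dot_ae0.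
rewrite /ip !Rintegral_ae0 ?mulr0 ?subr0 ?addr0//;
  do ?by apply: filterS X2ae => x ->; rewrite ?mulr0 ?mul0r.
- by rewrite mulr0 addr0.
- by apply: filterS G0 => x ->; rewrite mulr0.
- by apply: filterS X1ae => x ->; rewrite mulr0.
Qed.
End bilinear_form.

Unset Implicit Arguments.

Theorem theorem3p1 (R : realType) (d : nat) (hd : d = 2%N \/ d = 3%N)
  (a L : 'I_d -> R) (hL : forall i, 0 < L i)
  (eps alpha beta M1 M2 : R) (heps : 0 < eps) (halpha : 0 < alpha)
  (hbeta : 0 < beta) (hM1 : 0 < M1) (hM2 : 0 < M2)
  (eh B : R) (heh : 0 < eh < 2^-1) (hB : 0 < B)
  (hGB : forall r : R, 0 < Gpot eh r + B)
  (dt : R) (hdt : 0 < dt)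
  (phin rhon U V W : Rpoint R d -> R)
  (hphin : H1per a L phin) (hrhon : L2per a L rhon)
  (hU : L2per a L U) (hV : L2per a L V) (hW : L2per a L W) :
  let A := opA a L eps alpha beta M1 M2 eh B dt phin rhon in
  (forall X Y, admissible a L X -> admissible a L Y ->
     pairing (A X) Y = pairing (A Y) X) /\
  (forall X, admissible a L X ->
     0 <= pairing (A X) X /\
     (pairing (A X) X = 0 <->
      (\forall x \ae mu_box a L, X.1 x = 0) /\
      (\forall x \ae mu_box a L, X.2 x = 0))).
Proof.
move=> A; split=> [X Y aX aY|X aX]; first exact: pairing_opA_sym.
split; first exact: pairing_opA_ge0.
by split=> [A0|[X1 X2]]; [exact: pairing_opA_eq0 A0|exact: pairing_opA_ae0].
Qed.
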